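(* Let $0<\beta<1$, let $b$ be a locally integrable (real-valued) function on $\mathbb{R}^n$ and let $\mu\in A_1$. For $1\le s<\infty$ consider the condition $$(\ast)_s\qquad \sup_Q\frac1{\mu(Q)^{\beta/n}}\left(\frac1{\mu(Q)}\int_Q|b(x)-2M^{\sharp}(b\chi_Q)(x)|^s\mu(x)^{1-s}\,dx\right)^{1/s}\le C\quad\text{for some finite constant } C,$$ where the supremum is taken over all cubes $Q\subset\mathbb{R}^n$. Then the following assertions are equivalent: (1) $b\in Lip_{\beta,\mu}$ and $b\ge0$ a.e. in $\mathbb{R}^n$. (2) There exists $1\le s<\infty$ such that $(\ast)_s$ holds. (3) For all $1\le s<\infty$, $(\ast)_s$ holds.
   Context: Cubes $Q\subset\mathbb{R}^n$ have sides parallel to the coordinate axes; $|Q|$ is Lebesgue measure; $\chi_Q$ is the characteristic function of $Q$; $f_Q=|Q|^{-1}\int_Q f(x)\,dx$. A weight is a nonnegative locally integrable function on $\mathbb{R}^n$, not a.e. equal to zero; $\mu(E)=\int_E\mu(x)\,dx$. $A_1$ is the Muckenhoupt class: $\mu\in A_1$ if there is a constant $C$ with $M(\mu)(x)\le C\mu(x)$ for a.e. $x$, where $M(f)(x)=\sup_{Q\ni x}\frac1{|Q|}\int_Q|f(y)|\,dy$ (supremum over all cubes containing $x$). The sharp function is $M^{\sharp}(f)(x)=\sup_{Q\ni x}\frac1{|Q|}\int_Q|f(y)-f_Q|\,dy$, the supremum being over all cubes $Q\subset\mathbb{R}^n$ containing $x$. The weighted Lipschitz space $Lip_{\beta,\mu}$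 is the set of $f\in L^1_{\mathrm{loc}}(\mathbb{R}^n)$ such that $$\|f\|_{Lip_{\beta,\mu}}=\sup_Q\frac1{\mu(Q)^{1+\beta/n}}\int_Q|f(x)-f_Q|\,dx<\infty,$$ the supremum being over all cubes $Q\subset\mathbb{R}^n$. *)

(* Defs.v *)
From HB Require Import structures.
From mathcomp Require Import all_boot all_order all_algebra.
From mathcomp Require Import all_classical all_reals all_analysis.

Set Implicit Arguments.
Unset Strict Implicit.
Unset Printing Implicit Defensive.

Import Order.TTheory GRing.Theory Num.Theory.
Import numFieldNormedType.Exports.

Local Open Scope classical_set_scope.
Local Open Scope ring_scope.

(* The ambient space R^d is 'rV[R]_n.+1, with d = n.+1 >= 1.                  *)

Section boxes.
Context {R : realType} {n : nat}.
Implicit Types a b : 'rV[R]_n.+1.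

Definition box a b : set 'rV[R]_n.+1 :=
  [set x | forall i, x ord0 i \in `[a ord0 i, b ord0 i]].

(* The maximum makes the volume of an empty box equal to 0. *)
Definition box_volume a b : R := \prod_(i < n.+1) Num.max 0 (b ord0 i - a ord0 i).

Definition is_cube (Q : set 'rV[R]_n.+1) : Prop :=
  exists a : 'rV[R]_n.+1, exists2 l : R, 0 < l & Q = box a (a + const_mx l).

End boxes.

(* Lebesgue measure on R^d is obtained by Caratheodory's construction from    *)
(* countable covers by boxes. The measurable sets are therefore all the       *)
(* Lebesgue measurable sets (the measure is complete), not just Borel sets.   *)
Section lebesgue_outer.
Context {R : realType} {n : nat}.
Local Notation V := 'rV[R]_n.+1.
Local Open Scope ereal_scope.
Implicit Types (A : set V) (B : (V * V)^nat).

Definition box_cover A : set ((V * V)^nat) :=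
  [set B | A `<=` \bigcup_k box (B k).1 (B k).2].

Definition lebesgue_outer A : \bar R :=
  ereal_inf [set \sum_(0 <= k <oo) (box_volume (B k).1 (B k).2)%:E
            | B in box_cover A].

Let vol (z : V * V) : \bar R := (box_volume z.1 z.2)%:E.

Let vol_ge0 z : 0 <= vol z.
Proof. by rewrite lee_fin; apply: prodr_ge0 => i _; rewrite le_max lexx. Qed.

Let lebesgue_outer_ge0 A : 0 <= lebesgue_outer A.
Proof.
apply: le_ereal_inf_tmp => _ [B _ <-]; apply: nneseries_ge0 => k _ _.
exact: vol_ge0.
Qed.

Let lebesgue_outer0 : lebesgue_outer set0 = 0.
Proof.
apply/eqP; rewrite eq_le lebesgue_outer_ge0 andbT.
apply: ereal_inf_lbound; exists (fun=> (0%R, 0%R)) => //=.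
apply: eseries0 => k _ _; rewrite /box_volume (bigD1 ord0)//=.
by rewrite !mxE subrr maxxx mul0r.
Qed.

Let le_lebesgue_outer : {homo lebesgue_outer : A B / A `<=` B >-> A <= B}.
Proof.
move=> A B AB; apply: le_ereal_inf_tmp => _ [F BF <-].
by apply: ereal_inf_lbound; exists F => //; exact: subset_trans AB BF.
Qed.

Let lebesgue_outer_sigma_subadditive : sigma_subadditive lebesgue_outer.
Proof.
move=> A; have [[i ioo]|] := pselect (exists i, lebesgue_outer (A i) = +oo).
  rewrite (eseries_pinfty _ _ ioo) ?leey// => k _.
  by rewrite -ltNye (lt_le_trans _ (lebesgue_outer_ge0 _)).
rewrite -forallNE => Aoo; apply/lee_addgt0Pr => e e0.
rewrite (le_trans _ (epsilon_trick _ _ (ltW e0)))//.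
pose P k B := box_cover (A k) B /\
  \sum_(0 <= j <oo) vol (B j) <= lebesgue_outer (A k) + (e / (2 ^ k.+1)%:R)%:E.
have [G PG] : {G : nat -> (V * V)^nat & forall k, P k (G k)}.
  apply: (@choice _ _ P) => k.
  have ek : (0 < e / (2 ^ k.+1)%:R)%R by rewrite divr_gt0.
  have fA : lebesgue_outer (A k) \is a fin_num.
    by rewrite ge0_fin_numE// ltey; apply/eqP; exact: Aoo.
  have [_ [B AB <-] lB] := lb_ereal_inf_adherent ek fA.
  by exists B; split => //; exact: ltW lB.
apply: (@le_trans _ _ (\sum_(0 <= k <oo) \sum_(0 <= j <oo) vol (G k j))); last first.
  apply: lee_nneseries => [k _ _|k _]; first exact: nneseries_ge0.
  exact: (PG k).2.
have /card_esym/ppcard_eqP[f] := card_nat2.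
apply: ereal_inf_lbound => /=; exists (fun k => G (f k).1 (f k).2).
  move=> x [k _ /((PG k).1)[j _ xkj]]; exists (f^-1%FUN (k, j)) => //=.
  by rewrite invK ?inE.
pose v (z : nat * nat) := vol (G z.1 z.2).
have v0 z : 0 <= v z by exact: vol_ge0.
transitivity (\esum_(z in [set: nat * nat]) v z).
  have -> : \esum_(z in [set: nat * nat]) v z = \esum_(z in f @` setT) v z.
    by rewrite image_eq.
  by rewrite -(esum_pred_image v _ xpredT) ?[fun=> _]set_true.
rewrite nneseries_esumT; last first.
  by move=> k; apply: nneseries_ge0 => j _ _; exact: v0 (k, j).
rewrite (_ : setT = setT `*`` (fun=> setT)); last first.
  by apply/seteqP; split => // -[].
rewrite -(@esum_esum _ _ _ _ _ (fun k j => v (k, j)))//.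
by apply: eq_esum => k _; rewrite nneseries_esumT.
Qed.

HB.instance Definition _ := isOuterMeasure.Build R V lebesgue_outer
  lebesgue_outer0 lebesgue_outer_ge0 le_lebesgue_outer
  lebesgue_outer_sigma_subadditive.

End lebesgue_outer.

Definition lebesgueRn (R : realType) (n : nat) :
    set (caratheodory_type (@lebesgue_outer R n)) -> \bar R :=
  @lebesgue_outer R n.

HB.instance Definition _ (R : realType) (n : nat) :=
  isMeasure.Build _ _ _ (@lebesgueRn R n)
    (@caratheodory_measure0 _ _ (@lebesgue_outer R n))
    (@caratheodory_measure_ge0 _ _ (@lebesgue_outer R n))
    (@caratheodory_measure_sigma_additive _ _ (@lebesgue_outer R n)).

Section weighted_lipschitz.
Context {R : realType} {n : nat}.
Local Notation V := 'rV[R]_n.+1.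
Local Notation lambda := (@lebesgueRn R n).
Implicit Types (f w b : V -> R) (Q : set V) (x : V) (beta s : R).

Definition Rn_measurable_fun f : Prop :=
  measurable_fun [set: caratheodory_type (@lebesgue_outer R n)] f.

Definition Rn_locally_integrable f : Prop := Rn_measurable_fun f /\
  forall K : set V, compact K -> (\int[lambda]_(x in K) `|f x|%:E < +oo)%E.

Definition cube_average f Q : R :=
  (fine (lambda Q))^-1 * \int[lambda]_(y in Q) f y.

Local Open Scope ereal_scope.

Definition maximal_fun f x : \bar R :=
  ereal_sup [set (lambda Q)^-1 * \int[lambda]_(y in Q) `|f y|%:E
            | Q in [set Q | is_cube Q /\ Q x]].

Definition oscillation f Q : \bar R :=
  \int[lambda]_(y in Q) `|f y - cube_average f Q|%:E.

Definition sharp_maximal_fun f x : \bar R :=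
  ereal_sup [set (lambda Q)^-1 * oscillation f Q
            | Q in [set Q | is_cube Q /\ Q x]].

Definition weight w : Prop :=
  [/\ forall x, (0 <= w x)%R, Rn_locally_integrable w
    & ~ {ae lambda, forall x, w x = 0%R}].

Definition A1 w : Prop := weight w /\
  exists C : R, {ae lambda, forall x, maximal_fun w x <= (C * w x)%:E}.

Definition weight_measure w Q : \bar R := \int[lambda]_(x in Q) (w x)%:E.

Definition Lip_norm beta w f : \bar R :=
  ereal_sup [set (weight_measure w Q `^ (1 + beta / n.+1%:R))^-1
                 * oscillation f Q
            | Q in is_cube].

Definition Lip beta w f : Prop :=
  Rn_locally_integrable f /\ Lip_norm beta w f < +oo.

(* |b - 2 M^#(b chi_Q)| is extended-real valued since M^# may be infinite at  *)
(* some points.                                                               *)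
Definition sharp_condition beta w b s : Prop :=
  exists C : R,
    ereal_sup [set (weight_measure w Q `^ (beta / n.+1%:R))^-1 *
        ((weight_measure w Q)^-1 *
         \int[lambda]_(x in Q)
           (`|(b x)%:E - 2%:E * sharp_maximal_fun (b \* \1_Q)%R x| `^ s
            * (w x `^ (1 - s))%:E)) `^ s^-1
      | Q in is_cube] <= C%:E.

End weighted_lipschitz.

(* Main.v *)
(* The argument uses a.e. oscillation bounds on cubes and needs neither the     *)
(* Lebesgue differentiation theorem nor Hoelder's inequality. Since mu is A1,   *)
(* halving the side of a cube multiplies its mass by at most some th < 1. So a  *)
(* quantity e(Q) that is subadditive under the subdivision of Q into its 2^d    *)
(* children and satisfies e(Q) <= A mu(Q)^(1+g), with g = beta/d > 0, is <= 0   *)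
(* (self-improvement: each subdivision gains a factor th^g).                    *)
(*                                                                              *)
(* Sharp condition => Lip and b >= 0: always |b_Q| <= 2 M#(b 1_Q) on Q, so the  *)
(* function (|b_Q| - b)^+ has integral <= A mu(Q)^(1+g). It dominates           *)
(* (b_Q - b)^+, whose integral is half the oscillation, and it dominates b^-,   *)
(* whose integral must then vanish by self-improvement.                         *)
(*                                                                              *)
(* Lip and b >= 0 => sharp condition: self-improvement applied to the integral  *)
(* of (|b - b_Q| - K mu(Q)^g mu)^+ shows that |b(x) - b_Q| <= K mu(Q)^g mu(x)   *)
(* for a.e. x and all cubes Q containing x. Comparing b with the constant b(x)  *)
(* on Q, this gives |b(x) - 2 M#(b 1_Q)(x)| <= B mu(Q)^g mu(x), and the s-th    *)
(* power of this bound is integrated against mu^(1-s).                          *)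

Require Import Defs.
From mathcomp Require Import all_boot all_order all_algebra.
From mathcomp Require Import all_classical all_reals all_analysis.
From mathcomp Require Import measurable_realfun ring lra.

Set Implicit Arguments.
Unset Strict Implicit.
Unset Printing Implicit Defensive.

Import Order.TTheory GRing.Theory Num.Theory.
Import numFieldNormedType.Exports.

Local Open Scope classical_set_scope.
Local Open Scope ring_scope.

(** * Lebesgue measure of cubes *)

(** The factor 2 in the sharp condition comes from the indicator of a cube [Q]: its mean oscillation
    over a cube [Q'] is 2 al (1 - al), where al is the share of [Q'] lying in [Q], hence at most
    1/2, with equality for a cube containing [Q] and of twice its volume. So b - 2 M#(b 1_Q)
    vanishes on [Q] for a constant b >= 0 and equals 2b for a constant b < 0: the condition sees
    both oscillation and sign. For general b, [average_le_sharp] bounds 2 M#(b 1_Q) from below by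
    |b_Q|, and [sharp_le] bounds it from above by c + 4N when b deviates from the constant c >= 0 by
    at most N in mean on the subcubes of [Q] through the point.

    The A1 condition is applied as mu(Q) <= C |Q| mu(x), which trades masses of cubes for values of
    mu. Integrated, it gives doubling, then the decay [mass_child_le] behind [self_improvement].
    That lemma serves twice: in [oscillation_cube_ae] it turns mean bounds into pointwise ones, and
    in [sharp_condition_Lip] it removes the negative part of b. *)

Section boxes.
Context {R : realType} {n : nat}.
Local Notation V := 'rV[R]_n.+1.
Local Notation lambda := (@lebesgueRn R n).
Implicit Types (a b x : V) (l : R).

Local Notation CV := (caratheodory_type (@lebesgue_outer R n)).

(** Typed in [CV], whose measurable sets are the Lebesgue measurable ones, so that integrals over
    cubes refer to that sigma-algebra. *)
Definition cube a l : set CV := box a (a + const_mx l).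

Lemma boxP a b x : box a b x <-> forall i, a ord0 i <= x ord0 i <= b ord0 i.
Proof. by split=> H i; have := H i; rewrite /= in_itv. Qed.

Lemma cubeP a l x :
  cube a l x <-> forall i, a ord0 i <= x ord0 i <= a ord0 i + l.
Proof. by split=> [/boxP|] H; [|apply/boxP]; move=> i; have := H i; rewrite !mxE. Qed.

Lemma subset_box a b a' b' : (forall i, a' ord0 i <= a ord0 i) ->
  (forall i, b ord0 i <= b' ord0 i) -> box a b `<=` box a' b'.
Proof.
move=> aa bb x /boxP abx; apply/boxP => i; have /andP[ax xb] := abx i.
by rewrite (le_trans (aa i))//= (le_trans xb).
Qed.

Lemma box_volume_ge0 a b : 0 <= box_volume a b.
Proof. by apply: prodr_ge0 => i _; rewrite le_max lexx. Qed.

Lemma lebesgueRn_cover (A : set V) (B : (V * V)^nat) :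
  A `<=` \bigcup_k box (B k).1 (B k).2 ->
  (lambda A <= \sum_(0 <= k <oo) (box_volume (B k).1 (B k).2)%:E)%E.
Proof. by move=> AB; apply: ereal_inf_lbound; exists B. Qed.

Lemma lebesgueRn_box_le a b : (lambda (box a b) <= (box_volume a b)%:E)%E.
Proof.
pose B k := if k is 0%N then (a, b) else (0 : V, 0 : V).
apply: (@le_trans _ _ (\sum_(0 <= k <oo) (box_volume (B k).1 (B k).2)%:E))%E.
  by apply: lebesgueRn_cover => x abx; exists 0%N.
rewrite (@nneseries_split _ _ 0 1) => [|k _]; last first.
  by rewrite lee_fin box_volume_ge0.
rewrite add0n big_nat1 eseries0 ?adde0// => k; rewrite /B; case: k => //= k _ _.
by rewrite /box_volume (bigD1 ord0)//= mxE subr0 maxxx mul0r.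
Qed.

Definition set_coord a (i : 'I_n.+1) (c : R) : V :=
  \row_j (if j == i then c else a ord0 j).

(** The clamping by minimum and maximum covers hyperplanes that miss the box: one of the two parts
    then has volume 0. *)
Lemma box_volume_split a b i c :
  box_volume a (set_coord b i (Num.min (b ord0 i) c)) +
  box_volume (set_coord a i (Num.max (a ord0 i) c)) b = box_volume a b.
Proof.
have D1 a' b' : box_volume a' b' = Num.max 0 (b' ord0 i - a' ord0 i) *
    \prod_(j < n.+1 | j != i) Num.max 0 (b' ord0 j - a' ord0 j).
  by rewrite /box_volume (bigD1 i).
rewrite !D1 !mxE eqxx.
under eq_bigr => j /negbTE ji do rewrite mxE ji.
under [X in _ + _ * X]eq_bigr => j /negbTE ji do rewrite mxE ji.
rewrite -mulrDl; congr (_ * _).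
rewrite !maxEle !minEle; repeat case: ifPn; rewrite -?ltNge; lra.
Qed.

(** Caratheodory's criterion: cutting every box of a cover along the hyperplane gives covers of both
    parts at no extra volume. Squeezing [H] treats open and closed half-spaces together. *)
Lemma measurable_halfspace i c (H : set V) :
  [set x : V | x ord0 i < c] `<=` H -> H `<=` [set x : V | x ord0 i <= c] ->
  measurable (H : set (caratheodory_type (@lebesgue_outer R n))).
Proof.
move=> ltH Hle; apply: le_caratheodory_measurable => X.
apply: le_ereal_inf_tmp => _ [B XB <-].
pose B1 k := ((B k).1, set_coord (B k).2 i (Num.min ((B k).2 ord0 i) c)).
pose B2 k := (set_coord (B k).1 i (Num.max ((B k).1 ord0 i) c), (B k).2).
apply: (@le_trans _ _ (\sum_(0 <= k <oo) (box_volume (B1 k).1 (B1 k).2)%:E +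
                       \sum_(0 <= k <oo) (box_volume (B2 k).1 (B2 k).2)%:E))%E.
  apply: leeD; apply: lebesgueRn_cover => x [/XB[k _ /boxP Bx]].
    move/Hle => /= xc; exists k => //; apply/boxP => j /=.
    have /andP[B1x xB2] := Bx j; rewrite B1x mxE; case: eqP => // jE.
    by rewrite le_min -jE xB2 jE.
  move=> nHx; have cx : c <= x ord0 i by rewrite leNgt; apply/negP => /ltH.
  exists k => //; apply/boxP => j /=.
  have /andP[B1x xB2] := Bx j; rewrite xB2 mxE; case: eqP => [jE|_].
    by rewrite ge_max -jE B1x jE cx.
  by rewrite B1x.
rewrite -nneseriesD; do ?by move=> k _; rewrite lee_fin box_volume_ge0.
apply: lee_nneseries => k _.
  by rewrite adde_ge0// lee_fin box_volume_ge0.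
by rewrite -EFinD lee_fin box_volume_split.
Qed.

Lemma measurable_box a b : measurable (box a b : set CV).
Proof.
rewrite (_ : box a b = \bigcap_(i in [set: 'I_n.+1])
    (~` [set x : V | x ord0 i < a ord0 i] `&` [set x : V | x ord0 i <= b ord0 i])).
  apply: fin_bigcap_measurable => // i _; apply: (@measurableI _ CV).
    apply: (@measurableC _ CV); apply: (@measurable_halfspace i (a ord0 i)) => //= x.
    exact: ltW.
  by apply: (@measurable_halfspace i (b ord0 i)) => //= x; exact: ltW.
apply/seteqP; split => x.
  move=> /boxP abx i _ /=; have /andP[ax xb] := abx i; split => //.
  by apply/negP; rewrite -leNgt.
move=> H; apply/boxP => i; have [/= /negP] := H i Logic.I.
by rewrite -leNgt => -> ->.
Qed.

Lemma measurable_cube a l : measurable (cube a l : set CV).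
Proof. exact: measurable_box. Qed.

(** The homothety [phi] sends one cube onto the other and turns covers into covers, multiplying
    volumes of boxes by r^d. Exchanging the roles of the cubes gives equality, with no need to
    compute the measure of any cube. *)
Lemma lebesgueRn_cube_scale a l a' l' : 0 < l -> 0 < l' ->
  (((l / l') ^+ n.+1)^-1%:E * lambda (cube a l) <= lambda (cube a' l'))%E.
Proof.
move=> l0 l'0; set r := l / l'; have r0 : 0 < r by rewrite divr_gt0.
apply: le_ereal_inf_tmp => _ [B QB <-].
rewrite lee_pdivrMl ?exprn_gt0//.
pose phi (x : V) : V := a + r *: (x - a').
rewrite -nneseriesZl => [|k _]; last by rewrite lee_fin box_volume_ge0.
apply: (@le_trans _ _
    (\sum_(0 <= k <oo) (box_volume (phi (B k).1) (phi (B k).2))%:E)%E).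
  apply: (@lebesgueRn_cover _ (fun k => (phi (B k).1, phi (B k).2))) => x /cubeP ax.
  have : cube a' l' (a' + r^-1 *: (x - a)).
    apply/cubeP => i; rewrite !mxE; have /andP[h1 h2] := ax i.
    rewrite lerDl mulr_ge0 ?invr_ge0 ?(ltW r0) ?subr_ge0//= lerD2l.
    by rewrite /r invf_div mulrAC ler_pdivrMr// ler_wpM2l ?(ltW l'0)// lerBlDl.
  move=> /QB[k _ /boxP Bk]; exists k => //; apply/boxP => i /=.
  have := Bk i; rewrite !mxE; set y := r^-1 * _ => /andP[h1 h2].
  have -> : x ord0 i = a ord0 i + r * y by rewrite /y mulVKf ?gt_eqF//; lra.
  by rewrite !lerD2l !ler_pM2l//; lra.
apply: lee_nneseries => [k _|k _]; first by rewrite lee_fin box_volume_ge0.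
rewrite -EFinM lee_fin /box_volume.
rewrite (_ : r ^+ _ = \prod_(i < n.+1) r); last by rewrite prodr_const card_ord.
rewrite -big_split/= le_eqVlt; apply/orP; left; apply/eqP/eq_bigr => i _.
rewrite !mxE maxr_pMr ?(ltW r0)// mulr0; congr Num.max; ring.
Qed.

(* Its value 1 is never needed: all estimates are scale invariant, and it is
   positive as soon as some weight exists. *)
Definition unit_cube_measure : R := fine (lambda (cube 0 1)).

Lemma lebesgueRn_cube a l : 0 < l ->
  lambda (cube a l) = (unit_cube_measure * l ^+ n.+1)%:E.
Proof.
move=> l0; have l'0 := ltW l0.
have -> : lambda (cube a l) = ((l ^+ n.+1)%:E * lambda (cube 0 1))%E.
  apply/eqP; rewrite eq_le; apply/andP; split.
    rewrite -lee_pdivrMl ?exprn_gt0//.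
    by have := @lebesgueRn_cube_scale a l 0 1 l0 ltr01; rewrite divr1.
  have := @lebesgueRn_cube_scale 0 1 a l ltr01 l0.
  by rewrite div1r exprVn invrK.
rewrite EFinM muleC fineK// ge0_fin_numE//.
by rewrite (le_lt_trans (lebesgueRn_box_le _ _)) ?ltry.
Qed.

Definition centered_cube (k : nat) : set CV := cube (const_mx (- k%:R)) (k%:R *+ 2).

Lemma centered_cubeP k x : centered_cube k x <-> forall i, `|x ord0 i| <= k%:R.
Proof.
split=> [/cubeP|] H; [|apply/cubeP]; move=> i; have := H i;
  by rewrite ler_norml !mxE mulr2n addKr.
Qed.

(** The bound on [m] lets the cube contain, besides [x], a centered cube given in advance. *)
Lemma centered_cube_cover x k : exists2 m, (k < m)%N & centered_cube m x.
Proof.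
exists (k + \max_(i < n.+1) (Num.truncn `|x ord0 i|)).+1; first by rewrite ltnS leq_addr.
apply/centered_cubeP => i; rewrite (le_trans (ltW (truncnS_gt _)))// ler_nat ltnS.
by rewrite (leq_trans _ (leq_addl _ _))//; exact: (leq_bigmax i).
Qed.

Lemma subset_centered_cube k m : (k <= m)%N -> centered_cube k `<=` centered_cube m.
Proof.
move=> km x /centered_cubeP H; apply/centered_cubeP => i.
by rewrite (le_trans (H i))// ler_nat.
Qed.

(** If the unit cube were null, so would be every cube, then the whole space, and [w] would vanish
    almost everywhere. *)
Lemma unit_cube_measure_gt0 (w : V -> R) :
  ~ {ae lambda, forall x, w x = 0} -> 0 < unit_cube_measure.
Proof.
move=> w0; rewrite lt_neqAle fine_ge0// andbT; apply/negP => /eqP c0; apply: w0.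
pose Q (k : nat) := centered_cube k.+1.
have mQ : measurable (\bigcup_k Q k).
  by apply: bigcup_measurable => k _; exact: measurable_cube.
exists (\bigcup_k Q k); split => //.
- apply/negligibleP => //; apply: negligible_bigcup => k.
  apply/negligibleP; first exact: measurable_cube.
  apply: etrans (lebesgueRn_cube _ _) _; first by rewrite pmulrn_lgt0.
  by rewrite -c0 mul0r.
- by move=> x _; have [[//|m] _ mx] := centered_cube_cover x 0; exists m.
Qed.

Definition child_corner a l (s : {ffun 'I_n.+1 -> bool}) : V :=
  \row_j (a ord0 j + (s j)%:R * (l / 2)).

Lemma child_subset a l s : 0 < l -> cube (child_corner a l s) (l / 2) `<=` cube a l.
Proof.
by move=> l0; apply: subset_box => i; rewrite !mxE; case: (s i) => /=; lra.
Qed.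

Lemma cube_subdivision a l (f : CV -> \bar R) : 0 < l ->
  measurable_fun [set: CV] f -> (forall x, 0 <= f x)%E ->
  (\sum_s \int[lambda]_(x in cube (child_corner a l s) (l / 2)) f x =
   \int[lambda]_(x in cube a l) f x)%E.
Proof.
move=> l0 mf f0; set P := cube a l.
pose Q s := cube (child_corner a l s) (l / 2).
have mP : measurable (P : set CV) by exact: measurable_cube.
have mQ s : measurable (Q s : set CV) by exact: measurable_cube.
have fQ0 s x : (0 <= (f \_ (Q s)) x)%E by rewrite patchE; case: ifP.
have mfQ s : measurable_fun P (f \_ (Q s)).
  apply: measurable_funTS; apply/(measurable_restrictT _ _).1 => //.
  exact: measurable_funTS.
under eq_bigr => s _.
  rewrite (_ : cube _ _ = P `&` Q s); last by rewrite setIidr//; exact: child_subset.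
  rewrite integral_mkcondr; over.
rewrite -ge0_integral_sum//.
apply: ge0_ae_eq_integral => //.
- exact: emeasurable_sum.
- exact: measurable_funTS.
- by move=> x _; apply: sume_ge0.
(* The closed children overlap only on the middle slices [N i], which are degenerate boxes and hence
   null. *)
pose N i := box (set_coord a i (a ord0 i + l / 2))
                (set_coord (a + const_mx l) i (a ord0 i + l / 2)).
have N0 : lambda.-negligible (\big[setU/set0]_(i < n.+1) (N i : set CV)).
  elim/big_ind : _ => //.
  - exact: negligible_set0.
  - by move=> A B; exact: negligibleU.
  move=> i _; apply/negligibleP; first exact: measurable_box.
  apply/eqP; rewrite eq_le measure_ge0 andbT.
  rewrite (le_trans (lebesgueRn_box_le _ _))// lee_fin /box_volume (bigD1 i)//=.
  by rewrite !mxE eqxx subrr maxxx mul0r.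
apply: negligibleS N0 => x /= /not_implyP[Px]; apply: contra_notP => nNx.
have {}nNx i : x ord0 i != a ord0 i + l / 2.
  apply/eqP => xi; apply: nNx; rewrite (bigD1 i)//=; left; apply/boxP => j; rewrite !mxE.
  by case: eqP => [->|_]; rewrite ?xi ?lexx//; move/cubeP : Px.
(* Off the slices, comparing coordinates with the midpoints singles out the one child containing
   [x]. *)
pose s : {ffun 'I_n.+1 -> bool} := [ffun i => a ord0 i + l / 2 < x ord0 i].
have Qs t : Q t x <-> t = s.
  split=> [/cubeP Qt|->].
    apply/ffunP => i; rewrite ffunE; have := Qt i; have := nNx i; rewrite mxE.
    by case: (t i) => /=; case: ltgtP => //; lra.
  apply/cubeP => i; rewrite mxE ffunE; move/cubeP : Px => /(_ i).
  by have := nNx i; case: ltgtP => //=; lra.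
rewrite (bigD1 s)//= big1 => [|t ts].
  by rewrite adde0 patchE mem_set//; exact/Qs.
by rewrite patchE memNset// => /Qs; exact/eqP.
Qed.

End boxes.

#[local] Hint Extern 0 (measurable (cube _ _)) => (exact: measurable_cube) : core.

(** * Integrals and averages over cubes *)

Lemma lebesgueRn_ae_filter (R : realType) (n : nat) :
  Filter (almost_everywhere (@lebesgueRn R n)).
Proof.
exact: (@ae_filter_ringOfSetsType _ (caratheodory_type (@lebesgue_outer R n)) R
  (@lebesgueRn R n)).
Qed.
#[local] Hint Extern 0 (Filter (nbhs (almost_everywhere (@lebesgueRn _ _)))) =>
  (apply: lebesgueRn_ae_filter) : typeclass_instances.
#[local] Hint Extern 0 (Filter (almost_everywhere (@lebesgueRn _ _))) =>
  (apply: lebesgueRn_ae_filter) : typeclass_instances.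

Section cube_integrals.
Context {R : realType} {n : nat}.
Local Notation V := 'rV[R]_n.+1.
Local Notation CV := (caratheodory_type (@lebesgue_outer R n)).
Local Notation lambda := (@lebesgueRn R n).
Implicit Types (a : V) (l : R) (f g : CV -> R).

Lemma compact_cube a l : compact (cube a l : set V).
Proof.
exact: (@rV_compact _ _ (fun i => `[a ord0 i, (a + const_mx l) ord0 i]%classic)
  (fun i => @segment_compact _ _ _)).
Qed.

Lemma cube_integrable (f : V -> R) a l : Rn_locally_integrable f ->
  lambda.-integrable (cube a l) (EFin \o f).
Proof.
move=> [mf fK]; apply/integrableP; split.
  by apply/measurable_EFinP; exact: measurable_funTS.
by have := fK _ (compact_cube (a:=a) (l:=l)).
Qed.

Lemma ae_le_Rintegral (D : set CV) (f1 f2 : CV -> R) : measurable D ->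
  lambda.-integrable D (EFin \o f1) -> lambda.-integrable D (EFin \o f2) ->
  (forall x, 0 <= f1 x) -> (forall x, 0 <= f2 x) ->
  {ae lambda, forall x, D x -> f1 x <= f2 x} ->
  \int[lambda]_(x in D) f1 x <= \int[lambda]_(x in D) f2 x.
Proof.
move=> mD if1 if2 f10 f20 f12; rewrite /Rintegral; apply: fine_le.
- exact: (integrable_fin_num mD if1).
- exact: (integrable_fin_num mD if2).
apply: ae_ge0_le_integral => //.
- by move=> x _; rewrite lee_fin.
- exact: (measurable_int lambda if1).
- by move=> x _; rewrite lee_fin.
- exact: (measurable_int lambda if2).
Qed.

Lemma Rintegral_le0_ae (D : set CV) (f : CV -> R) : measurable D ->
  lambda.-integrable D (EFin \o f) -> (forall x, 0 <= f x) ->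
  \int[lambda]_(x in D) f x <= 0 -> {ae lambda, forall x, D x -> f x = 0}.
Proof.
move=> mD fi f0 If.
have {}If : \int[lambda]_(x in D) f x = 0.
  by apply/eqP; rewrite eq_le If Rintegral_ge0.
have : (\int[lambda]_(x in D) `|(f x)%:E| = 0)%E.
  under eq_integral do rewrite gee0_abs ?lee_fin//.
  by rewrite -(fineK (integrable_fin_num mD fi)) [fine _]If.
move/(ae_eq_integral_abs _ mD (measurable_int lambda fi)); apply: filterS => x H Qx.
by have := H Qx; case.
Qed.

Lemma Rintegral_children (f : CV -> R) a l : 0 < l -> measurable_fun [set: CV] f ->
  (forall a l, 0 < l -> lambda.-integrable (cube a l) (EFin \o f)) ->
  (forall x, 0 <= f x) ->
  \sum_s \int[lambda]_(x in cube (child_corner a l s) (l / 2)) f x =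
  \int[lambda]_(x in cube a l) f x.
Proof.
move=> l0 mf fi f0.
have mf' : measurable_fun [set: CV] (fun x => (f x)%:E) by exact/measurable_EFinP.
have f0' (x : CV) : (0 <= (f x)%:E)%E by rewrite lee_fin.
have l20 : 0 < l / 2 by rewrite divr_gt0.
have intE b k : 0 < k -> (\int[lambda]_(x in cube b k) (f x)%:E =
                          (\int[lambda]_(x in cube b k) f x)%:E)%E.
  by move=> k0; rewrite fineK//; exact: (integrable_fin_num (measurable_cube _ _) (fi _ _ k0)).
have := cube_subdivision a l0 mf' f0'; rewrite intE//.
by under eq_bigr do rewrite intE//; rewrite sumEFin => -[].
Qed.

Hypothesis c_gt0 : 0 < @unit_cube_measure R n.

Definition cube_volume l : R := @unit_cube_measure R n * l ^+ n.+1.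

Lemma cube_volume_gt0 l : 0 < l -> 0 < cube_volume l.
Proof. by move=> l0; rewrite mulr_gt0// exprn_gt0. Qed.

Lemma cube_volumeM k l : cube_volume (k * l) = k ^+ n.+1 * cube_volume l.
Proof. by rewrite /cube_volume exprMn mulrCA. Qed.

Lemma cube_volume_double l l' : 0 < l -> 0 < l' -> l' <= 2 * l ->
  cube_volume l' <= 2 ^+ n.+1 * cube_volume l.
Proof.
move=> l0 l'0 ll; rewrite -cube_volumeM /cube_volume ler_pM2l//.
by rewrite lerXn2r ?nnegrE ?mulr_ge0 ?(ltW l0) ?(ltW l'0).
Qed.

Lemma cube_averageE (f : V -> R) a l : 0 < l ->
  cube_average f (cube a l) =
  (cube_volume l)^-1 * \int[lambda]_(y in cube a l) f y.
Proof. by move=> l0; rewrite /cube_average lebesgueRn_cube. Qed.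

Lemma cst_integrable a l (c : R) : 0 < l ->
  lambda.-integrable (cube a l) (EFin \o (fun=> c)).
Proof.
move=> l0; apply: measurable_bounded_integrable => //.
- by rewrite [X in (X < _)%E]lebesgueRn_cube// ltry.
- exact: bounded_cst.
Qed.

Lemma integral_cst_cube a l (c : R) : 0 < l ->
  \int[lambda]_(y in cube a l) c = c * cube_volume l.
Proof.
move=> l0; rewrite Rintegral_cst; last exact: measurable_cube.
by congr (_ * _); rewrite [X in fine X]lebesgueRn_cube.
Qed.

Section oscillation.
Variable f : V -> R.
Hypothesis fi : forall a l, lambda.-integrable (cube a l) (EFin \o f).

Definition osc a l : R :=
  \int[lambda]_(y in cube a l) `|f y - cube_average f (cube a l)|.

Lemma subc_integrable a l a' l' (c : R) : 0 < l' -> cube a l `<=` cube a' l' ->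
  lambda.-integrable (cube a l) (EFin \o (fun x => f x - c)).
Proof.
move=> l0 sub; have mQ b k := @measurable_cube R n b k.
have cc := integrableS (mQ _ _) (mQ _ _) sub (@cst_integrable a' _ c l0).
exact: (integrableB (mQ _ _) (fi _ _) cc).
Qed.

Lemma subc_norm_integrable a l (c : R) : 0 < l ->
  lambda.-integrable (cube a l) (EFin \o (fun x => `|f x - c|)).
Proof. by move=> l0; apply: integrable_norm; exact: (@subc_integrable _ _ a l). Qed.

Lemma oscillationE a l : 0 < l -> oscillation f (cube a l) = (osc a l)%:E.
Proof.
move=> l0; rewrite /oscillation /osc /Rintegral fineK//.
exact: (integrable_fin_num (measurable_cube _ _) (subc_norm_integrable _ _ _)).
Qed.

Lemma integral_subc a l c : 0 < l -> \int[lambda]_(y in cube a l) (f y - c) =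
  (cube_average f (cube a l) - c) * cube_volume l.
Proof.
move=> l0; rewrite (RintegralB (measurable_cube _ _) (fi _ _) (cst_integrable _ _ l0)).
rewrite integral_cst_cube// cube_averageE// mulrBl mulrAC mulVf ?mul1r//.
by rewrite gt_eqF// cube_volume_gt0.
Qed.

Lemma average_sub_le a l c : 0 < l ->
  `|cube_average f (cube a l) - c| * cube_volume l <=
  \int[lambda]_(y in cube a l) `|f y - c|.
Proof.
move=> l0; rewrite -[X in _ * X]gtr0_norm ?cube_volume_gt0// -normrM.
rewrite -integral_subc//; apply: le_normr_Rintegral; first exact: measurable_cube.
exact: (@subc_integrable _ _ a l).
Qed.

Lemma nested_average_le a l a' l' : 0 < l -> 0 < l' ->
  cube a l `<=` cube a' l' ->
  `|cube_average f (cube a l) - cube_average f (cube a' l')| * cube_volume l <=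
  osc a' l'.
Proof.
move=> l0 l'0 sub; apply: le_trans (average_sub_le _ _ l0) _.
have mQ b k := @measurable_cube R n b k.
have fi' := @subc_norm_integrable a' l' (cube_average f (cube a' l')) l'0.
have fi1 := @subc_norm_integrable a l (cube_average f (cube a' l')) l0.
rewrite /osc /Rintegral; apply: fine_le.
- exact: (integrable_fin_num (mQ _ _) fi1).
- exact: (integrable_fin_num (mQ _ _) fi').
- by apply: ge0_subset_integral => //; exact: (measurable_int lambda).
Qed.

Lemma integral_dist_le a l c : 0 < l ->
  \int[lambda]_(y in cube a l) `|f y - c| <=
  osc a l + `|cube_average f (cube a l) - c| * cube_volume l.
Proof.
move=> l0; have mQ := @measurable_cube R n a l.
have i1 := subc_norm_integrable a (cube_average f (cube a l)) l0.
have i2 := cst_integrable a `|cube_average f (cube a l) - c| l0.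
rewrite -(integral_cst_cube a _ l0) -(RintegralD mQ i1 i2).
apply: (le_Rintegral mQ (subc_norm_integrable a c l0) (integrableD mQ i1 i2)) => x _.
exact: ler_distD.
Qed.

(** A one-sided bound is enough because u = f - f_Q has integral 0: from u >= -g and g >= 0 follows
    |u| <= u + 2g, which is then integrated. *)
Lemma osc_le a l (g : CV -> R) : 0 < l ->
  lambda.-integrable (cube a l) (EFin \o g) -> (forall x, 0 <= g x) ->
  (forall x, cube a l x -> cube_average f (cube a l) - f x <= g x) ->
  osc a l <= 2 * \int[lambda]_(x in cube a l) g x.
Proof.
move=> l0 gi g0 fg; have mQ := @measurable_cube R n a l.
set c := cube_average f (cube a l).
have ui : lambda.-integrable (cube a l) (EFin \o (fun x => f x - c)).
  exact: (@subc_integrable _ _ a l).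
have vi : lambda.-integrable (cube a l) (EFin \o (fun x => 2 * g x)).
  exact: (integrableZl mQ _ gi).
apply: (@le_trans _ _ (\int[lambda]_(x in cube a l) ((f x - c) + 2 * g x))).
  apply: le_Rintegral => //; first exact: subc_norm_integrable.
    exact: (integrableD mQ ui vi).
  move=> x Qx; have := fg x Qx; have := g0 x; rewrite -/c.
  by case: (ger0P (f x - c)); lra.
by rewrite (RintegralD mQ ui vi) integral_subc// subrr mul0r add0r RintegralZl.
Qed.

End oscillation.

End cube_integrals.

Arguments cube_volume {R} n l.

(** * A1 weights *)

Lemma powR_1D (R : realType) (x g : R) : 0 <= x -> 0 < g ->
  x `^ (1 + g) = x * x `^ g.
Proof. by move=> x0 g0; rewrite -mulr_powRB1 ?addr_gt0// addrAC subrr add0r. Qed.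

Section A1_weights.
Context {R : realType} {n : nat}.
Local Notation V := 'rV[R]_n.+1.
Local Notation CV := (caratheodory_type (@lebesgue_outer R n)).
Local Notation lambda := (@lebesgueRn R n).
Implicit Types (a : V) (l : R) (w : V -> R).

Definition mass w a l : R := \int[lambda]_(x in cube a l) w x.

Variable w : V -> R.
Hypothesis wA1 : A1 w.

Let w_ge0 x : 0 <= w x. Proof. by case: wA1 => -[]. Qed.
Let w_loc : Rn_locally_integrable w. Proof. by case: wA1 => -[]. Qed.
Let mQ a l : measurable (cube a l : set CV). Proof. exact: measurable_cube. Qed.
Let wi a l : lambda.-integrable (cube a l) (EFin \o w).
Proof. exact: cube_integrable. Qed.

Lemma A1_unit_cube_measure : 0 < @unit_cube_measure R n.
Proof. by case: wA1 => -[_ _ wn0] _; exact: unit_cube_measure_gt0 wn0. Qed.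

Let c_gt0 := A1_unit_cube_measure.

Lemma weight_measureE a l : weight_measure w (cube a l) = (mass w a l)%:E.
Proof. by rewrite /mass /Rintegral fineK//; exact: (integrable_fin_num (mQ _ _) (wi _ _)). Qed.

(** The cubes are quantified inside the almost-everywhere statement: one exceptional null set serves
    them all. *)
Definition A1_bound C : Prop := {ae lambda, forall x, forall a l,
  0 < l -> cube a l x -> mass w a l <= C * cube_volume n l * w x}.

Lemma A1_mass_le : exists2 C, 1 <= C & A1_bound C.
Proof.
case: wA1 => _ [C wC]; exists (Num.max 1 C); first by rewrite le_max lexx.
move: wC; apply: filterS => x wC a l l0 Qx.
have : ((lambda (cube a l))^-1 * \int[lambda]_(y in cube a l) `|w y|%:E <= (C * w x)%:E)%E.
  by apply: le_trans wC; apply: ereal_sup_ubound; exists (cube a l) => //; split => //; exists a, l.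
under eq_integral do rewrite ger0_norm//.
rewrite -/(weight_measure w _) weight_measureE lebesgueRn_cube// -/(cube_volume n l).
have v0 : 0 < cube_volume n l by exact: cube_volume_gt0.
rewrite inver gt_eqF// -EFinM lee_fin ler_pdivrMl// => /le_trans; apply.
by rewrite mulrCA mulrA ler_wpM2r// ler_wpM2r ?(ltW v0)// le_max lexx orbT.
Qed.

Lemma mass_ge0 a l : 0 <= mass w a l.
Proof. by apply: Rintegral_ge0. Qed.

Lemma mass_subset a l a' l' : cube a l `<=` cube a' l' -> mass w a l <= mass w a' l'.
Proof.
move=> sub; rewrite /mass /Rintegral; apply: fine_le.
- exact: (integrable_fin_num (mQ _ _) (wi _ _)).
- exact: (integrable_fin_num (mQ _ _) (wi _ _)).
- apply: ge0_subset_integral => //; first exact: (measurable_int lambda (wi a' l')).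
  by move=> x _; rewrite lee_fin.
Qed.

(** [A1_bound] integrated over [E]. With [E] a smaller cube this becomes [A1_doubling]. *)
Lemma le_mass_integral C a l : A1_bound C ->
  0 < l -> 0 <= C -> forall E : set CV, measurable E -> E `<=` cube a l ->
  ((mass w a l)%:E * lambda E <=
   (C * cube_volume n l)%:E * \int[lambda]_(x in E) (w x)%:E)%E.
Proof.
move=> wC l0 C0 E mE EQ; have v0 := ltW (cube_volume_gt0 c_gt0 l0).
have mw : measurable_fun E (fun x : CV => (w x)%:E).
  apply: measurable_funS (measurable_int lambda (wi a l)) => //.
rewrite -integral_cst// -ge0_integralZl//; last by rewrite lee_fin mulr_ge0.
apply: ae_ge0_le_integral => //.
- by move=> x _; rewrite lee_fin mass_ge0.
- move=> x _; rewrite -EFinM lee_fin; apply: mulr_ge0; last exact: w_ge0.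
  exact: mulr_ge0.
- exact: measurable_funeM.
- move: wC; apply: filterS => x wC Ex.
  by rewrite -EFinM lee_fin; apply: wC => //; exact: EQ.
- by move=> x _; rewrite lee_fin.
Qed.

(** Some centered cube has positive mass. At a zero of [w] satisfying the A1 bound, every cube
    through the point would have mass 0, including one large enough to contain that centered
    cube. *)
Lemma A1_ae_gt0_mass_gt0 :
  {ae lambda, forall x, 0 < w x} /\ (forall a l, 0 < l -> 0 < mass w a l).
Proof.
have [C C1 wC] := A1_mass_le.
have mass0 a l : mass w a l <= 0 -> {ae lambda, forall x, cube a l x -> w x = 0}.
  exact: Rintegral_le0_ae.
have [k mk] : exists k, 0 < mass w (const_mx (- k.+1%:R)) (k.+1%:R *+ 2).
  apply: contrapT => /forallNP H; have [[_ _ wn0] _] := wA1; apply: wn0.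
  have : {ae lambda, forall x, forall k, centered_cube k.+1 x -> w x = 0}.
    by apply: ae_foralln => k; apply: mass0; rewrite leNgt; apply/negP/H.
  apply: filterS => x Hx; have [[//|m] _ mx] := centered_cube_cover x 0.
  exact: (Hx m).
have w_gt0 : {ae lambda, forall x, 0 < w x}.
  move: wC; apply: filterS => x wC; rewrite lt_neqAle w_ge0 andbT.
  apply/negP => /eqP wx0; have [m km mx] := centered_cube_cover x k.+1.
  have m0 : 0 < m%:R *+ 2 :> R by rewrite pmulrn_lgt0// ltr0n (leq_trans _ km).
  have := wC _ _ m0 mx; rewrite -wx0 mulr0 leNgt; apply/negP; rewrite negbK.
  exact: lt_le_trans mk (mass_subset (subset_centered_cube (ltnW km))).
split=> [|a l l0]; first exact: w_gt0.
rewrite ltNge; apply/negP => /mass0 Q0.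
have : lambda.-negligible (cube a l).
  have : {ae lambda, forall x : CV, ~ cube a l x}.
    by move: w_gt0 Q0; apply: filterS2 => x wx Q0 Qx; rewrite Q0 ?ltxx in wx.
  by apply: negligibleS => x Qx /=; exact.
move/(negligibleP _ (mQ _ _)); rewrite [X in X = _ -> _]lebesgueRn_cube//.
by case=> /eqP; rewrite gt_eqF//; exact: cube_volume_gt0.
Qed.

Lemma A1_doubling C a l a' l' : A1_bound C ->
  0 <= C -> 0 < l -> 0 < l' -> cube a l `<=` cube a' l' ->
  cube_volume n l * mass w a' l' <= C * cube_volume n l' * mass w a l.
Proof.
move=> wC C0 l0 l'0 sub.
have := @le_mass_integral C a' l' wC l'0 C0 _ (mQ a l) sub.
rewrite -/(weight_measure w _) weight_measureE [X in (_ * X <= _)%E](lebesgueRn_cube _ l0).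
by rewrite -!EFinM lee_fin mulrC.
Qed.

Lemma mass_children a l : 0 < l ->
  \sum_s mass w (child_corner a l s) (l / 2) = mass w a l.
Proof.
by move=> l0; apply: Rintegral_children => //; exact: w_loc.1.
Qed.

(** By doubling, every child carries at least the fraction 1/D of the mass, so a sibling withholds
    that much from any given child. *)
Lemma mass_child_le : exists2 th, 0 < th < 1 & forall a l s, 0 < l ->
  mass w (child_corner a l s) (l / 2) <= th * mass w a l.
Proof.
have [C C1 wC] := A1_mass_le; pose D : R := C * 2 ^+ n.+1.
have D1 : 1 < D.
  rewrite (lt_le_trans (_ : 1 < 2 ^+ n.+1))//; first by rewrite exprn_egt1// ltr1n.
  by rewrite ler_peMl// exprn_ge0.
have D0 : 0 < D by rewrite (lt_trans ltr01).
exists (1 - D^-1) => [|a l s l0].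
  by rewrite subr_gt0 invf_lt1// D1 ltrBlDr ltrDl invr_gt0.
have child_ge t : D^-1 * mass w a l <= mass w (child_corner a l t) (l / 2).
  have l20 : 0 < l / 2 by rewrite divr_gt0.
  have v0 := cube_volume_gt0 c_gt0 l20.
  have := A1_doubling wC (le_trans ler01 C1) l20 l0 (@child_subset R n a l t l0).
  have -> : cube_volume n l = 2 ^+ n.+1 * cube_volume n (l / 2).
    by rewrite -cube_volumeM; congr cube_volume; field.
  rewrite (_ : C * _ * _ = cube_volume n (l / 2) * (D * mass w (child_corner a l t) (l / 2))).
    by rewrite ler_pM2l// ler_pdivrMl.
  by rewrite /D; ring.
(* The child opposite to [s]; it differs from [s] since the dimension is at least 1. *)
pose t : {ffun 'I_n.+1 -> bool} := [ffun i => ~~ s i].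
have ts : t != s.
  by apply/eqP => /ffunP/(_ ord0); rewrite ffunE; case: (s ord0).
have := mass_children a l0; rewrite (bigD1 s)//= (bigD1 t)//=.
set S := \sum_(_ | _) _; have S0 : 0 <= S by apply: sumr_ge0 => i _; exact: mass_ge0.
by move=> E; rewrite mulrBl mul1r lerBrDr -[leRHS]E lerD2l (le_trans (child_ge t))// lerDl.
Qed.

(** Masses of children add up, so of the exponent 1 + g one unit is spent on the summation and the
    remaining g gains th^g < 1. Iterating the bound over [k] generations gives the factor (th^g)^k,
    which tends to 0. *)
Lemma self_improvement (g A : R) (e : V -> R -> R) : 0 < g -> 0 <= A ->
  (forall a l, 0 < l -> e a l <= \sum_s e (child_corner a l s) (l / 2)) ->
  (forall a l, 0 < l -> e a l <= A * mass w a l `^ (1 + g)) ->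
  forall a l, 0 < l -> e a l <= 0.
Proof.
move=> g0 A0 esub eA; have [th /andP[th0 th1] child_le] := mass_child_le.
have q1 : th `^ g < 1.
  have -> : 1 = 1 `^ g :> R by rewrite powR1.
  by rewrite gt0_ltr_powR// nnegrE ltW.
have mE a l : mass w a l `^ (1 + g) = mass w a l * mass w a l `^ g.
  by rewrite powR_1D ?mass_ge0.
have step k a l : 0 < l -> e a l <= A * (th `^ g) ^+ k * mass w a l `^ (1 + g).
  elim: k a l => [|k IH] a l l0; first by rewrite expr0 mulr1 eA.
  have l20 : 0 < l / 2 by rewrite divr_gt0.
  apply: le_trans (esub _ _ l0) _.
  apply: (@le_trans _ _ (\sum_s (A * (th `^ g) ^+ k * (th * mass w a l) `^ g) *
      mass w (child_corner a l s) (l / 2))).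
    apply: ler_sum => s _; apply: le_trans (IH _ _ l20) _.
    rewrite mE mulrCA mulrC ler_wpM2r ?mass_ge0//.
    rewrite ler_wpM2l ?mulr_ge0 ?exprn_ge0 ?powR_ge0//.
    by rewrite ge0_ler_powR ?nnegrE ?mulr_ge0 ?mass_ge0 ?(ltW th0) ?(ltW g0)// child_le.
  rewrite -mulr_sumr mass_children// mE powRM ?mass_ge0 ?(ltW th0)// exprSr.
  by rewrite le_eqVlt; apply/orP; left; apply/eqP; ring.
move=> a l l0; set B := mass w a l `^ (1 + g).
have cvg0 : (A * B) * (th `^ g) ^+ k @[k --> \oo] --> 0.
  by apply: cvg_geometric; rewrite ger0_norm// powR_ge0.
rewrite -(cvg_lim (@Rhausdorff R) cvg0); apply: limr_ge; first exact: cvgP cvg0.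
by apply: nearW => k; rewrite mulrAC; exact: step.
Qed.

End A1_weights.

(** * Pointwise oscillation bound *)

Section pointwise_bound.
Context {R : realType} {n : nat}.
Local Notation V := 'rV[R]_n.+1.
Local Notation CV := (caratheodory_type (@lebesgue_outer R n)).
Local Notation lambda := (@lebesgueRn R n).
Implicit Types (a : V) (l : R).

Variables (w b : V -> R) (g A : R).
Hypothesis wA1 : A1 w.
Hypothesis b_loc : Rn_locally_integrable b.
Hypothesis g_gt0 : 0 < g.
Hypothesis A_ge0 : 0 <= A.
Hypothesis oscA : forall a l, 0 < l -> osc b a l <= A * mass w a l `^ (1 + g).

Let c_gt0 := A1_unit_cube_measure wA1.
Let w_ge0 (x : CV) : 0 <= w x. Proof. by case: wA1 => -[]. Qed.
Let w_loc : Rn_locally_integrable w. Proof. by case: wA1 => -[]. Qed.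
Let bi a l : lambda.-integrable (cube a l) (EFin \o b).
Proof. exact: cube_integrable. Qed.
Let wi a l : lambda.-integrable (cube a l) (EFin \o w).
Proof. exact: cube_integrable. Qed.
Let mass_gt0 a l : 0 < l -> 0 < mass w a l.
Proof. exact: (A1_ae_gt0_mass_gt0 wA1).2. Qed.

(** The oscillation bound on the large cube carries mu(Q')^(1+g); the A1 bound at [x] exchanges one
    factor mu(Q') for |Q'| mu(x), and |Q'| is comparable to |Q|. *)
Lemma average_diff_le C x a l a' l' : 0 <= C -> 0 < l -> 0 < l' ->
  cube a l `<=` cube a' l' -> l' <= 2 * l ->
  mass w a' l' <= C * cube_volume n l' * w x ->
  `|cube_average b (cube a l) - cube_average b (cube a' l')| <=
  A * C * 2 ^+ n.+1 * mass w a' l' `^ g * w x.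
Proof.
move=> C0 l0 l'0 sub l'l wx; have v0 := cube_volume_gt0 c_gt0 l0.
rewrite -(ler_pM2r v0); apply: le_trans (nested_average_le c_gt0 bi l0 l'0 sub) _.
apply: le_trans (oscA _ l'0) _.
rewrite powR_1D ?(ltW (mass_gt0 _ _))//.
have v' := cube_volume_double c_gt0 l0 l'0 l'l.
have {}wx : mass w a' l' <= C * (2 ^+ n.+1 * cube_volume n l) * w x.
  by apply: le_trans wx _; rewrite ler_wpM2r// ler_wpM2l.
rewrite mulrA; apply: le_trans (ler_wpM2r (powR_ge0 _ _) (ler_wpM2l A_ge0 wx)) _.
by rewrite le_eqVlt; apply/orP; left; apply/eqP; ring.
Qed.

(* The constant is the fixed point of [K |-> D + K * th `^ g]: passing to a
   child costs [D], and the decay of the mass absorbs it. *)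
Lemma oscillation_cube_ae : exists2 K, 0 <= K & forall a l, 0 < l ->
  {ae lambda, forall x, cube a l x ->
    `|b x - cube_average b (cube a l)| <= K * mass w a l `^ g * w x}.
Proof.
have [C C1 wC] := A1_mass_le wA1; have C0 : 0 <= C := le_trans ler01 C1.
have [th /andP[th0 th1] child_le] := mass_child_le wA1.
have q1 : th `^ g < 1.
  have -> : 1 = 1 `^ g :> R by rewrite powR1.
  by rewrite gt0_ltr_powR// nnegrE ltW.
pose D : R := A * C * 2 ^+ n.+1; have D0 : 0 <= D by rewrite !mulr_ge0// exprn_ge0.
pose K : R := D / (1 - th `^ g).
have KD : K = D + K * th `^ g by rewrite /K; field; rewrite subr_eq0 gt_eqF.
have K0 : 0 <= K by rewrite divr_ge0// subr_ge0 ltW.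
clearbody K; exists K => //.
pose h a l (x : CV) : R :=
  Num.max 0 (`|b x - cube_average b (cube a l)| - K * mass w a l `^ g * w x).
have h0 a l x : 0 <= h a l x by rewrite le_max lexx.
have h_le a l x : h a l x <= `|b x - cube_average b (cube a l)|.
  by rewrite ge_max normr_ge0/= gerBl !mulr_ge0 ?powR_ge0.
have mh a l : measurable_fun [set: CV] (h a l).
  apply: measurable_maxr; first exact: measurable_cst.
  apply: measurable_funB.
    apply: measurableT_comp; first exact: normr_measurable.
    by apply: measurable_funB; [exact: b_loc.1|exact: measurable_cst].
  by apply: measurable_funM; [exact: measurable_cst|exact: w_loc.1].
have hi a l a' l' : 0 < l' -> lambda.-integrable (cube a' l') (EFin \o h a l).
  move=> l'0; have bci := subc_norm_integrable bi a' (cube_average b (cube a l)) l'0.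
  apply: le_integrable bci => //.
    by apply/measurable_EFinP; exact: measurable_funTS.
  by move=> x _; rewrite lee_fin normr_id ger0_norm ?h0// h_le.
have h_int a l : 0 < l -> \int[lambda]_(x in cube a l) h a l x <= 0.
  apply: (@self_improvement _ _ _ wA1 g A
    (fun a l => \int[lambda]_(x in cube a l) h a l x)) => // {a l} a l l0.
    have hE := Rintegral_children a l0 (mh a l) (hi a l) (h0 a l).
    rewrite /= -hE; apply: ler_sum => s _.
    have l20 : 0 < l / 2 by rewrite divr_gt0.
    apply: ae_le_Rintegral; [exact: measurable_cube|exact: hi|exact: hi|by []|by []|].
    (* Almost everywhere on a child, [h] of the parent is at most [h] of the child: changing the
       average costs D mu(P)^g mu(x), and replacing K mu(P)^g by the child's term frees at least
       that much, as K = D + K th^g. *)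
    move: wC; apply: filterS => x wC Qx; rewrite /h ge_max le_max lexx/=.
    have sub := @child_subset R n a l s l0.
    have Px := sub _ Qx; have {wC}wx := wC _ _ l0 Px.
    have l2 : l <= 2 * (l / 2) by rewrite mulrC divfK.
    have := average_diff_le C0 l20 l0 sub l2 wx; rewrite -/D.
    set bP := cube_average b (cube a l); set bQ := cube_average _ _ => bPQ.
    have bb : `|b x - bP| <= `|b x - bQ| + `|bQ - bP| by exact: ler_distD.
    have mm : mass w (child_corner a l s) (l / 2) `^ g <= th `^ g * mass w a l `^ g.
      rewrite -powRM ?mass_ge0 ?(ltW th0)//.
      by rewrite ge0_ler_powR ?nnegrE ?mulr_ge0 ?mass_ge0 ?(ltW th0) ?(ltW g_gt0)// child_le.
    have KQ := ler_wpM2r (w_ge0 x) (ler_wpM2l K0 mm).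
    have KP : K * mass w a l `^ g * w x =
        D * mass w a l `^ g * w x + K * (th `^ g * mass w a l `^ g) * w x.
      by rewrite {1}KD; ring.
    have arith (u v r p q d t : R) :
      u <= v + r -> r <= d -> q <= t -> p = d + t -> u - p <= v - q.
      by move=> uv rd qt ->; rewrite opprD addrA lerB// lerBlDr (le_trans uv)// lerD2l.
    by rewrite le_max (arith _ _ _ _ _ _ _ bb bPQ KQ KP) orbT.
  apply: le_trans (oscA a l0).
  apply: (le_Rintegral (measurable_cube a l) (hi a l a l l0)) => //.
  exact: (subc_norm_integrable bi).
move=> a l l0; have := Rintegral_le0_ae
  (measurable_cube a l) (hi a l a l l0) (h0 a l) (h_int a l l0).
apply: filterS => x H /H; rewrite /h => /eqP.
by rewrite eq_maxl subr_le0.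
Qed.

(** Countably many cubes approximate all cubes up to a factor 2 in the side. This upgrades a null
    set depending on the cube to a single one in [oscillation_ae]. *)
Lemma rational_cube a l : 0 < l -> exists (q : 'rV[rat]_n.+1) (r : rat),
  [/\ 0 < ratr r :> R, cube a l `<=` cube (map_mx ratr q : V) (ratr r)
    & ratr r <= 2 * l].
Proof.
move=> l0.
have [q qP] : {q : 'I_n.+1 -> rat & forall i,
    ratr (q i) \in `](a ord0 i - l / 4), (a ord0 i)[}.
  apply: (@choice _ _ (fun i q => ratr q \in `](a ord0 i - l / 4), (a ord0 i)[)) => i.
  by apply: rat_in_itvoo; lra.
have [r] : exists r : rat, ratr r \in `](l + l / 4), (2 * l)[.
  by have [|r] := @rat_in_itvoo R (l + l / 4) (2 * l); [lra|exists r].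
rewrite in_itv/= => /andP[r1 r2].
exists (\row_i q i), r; split; [lra| |exact: ltW].
move=> x /cubeP H; apply/cubeP => i; have := H i; have := qP i.
by rewrite in_itv/= !mxE; lra.
Qed.

Lemma oscillation_ae : exists2 K, 0 <= K & {ae lambda, forall x, forall a l,
  0 < l -> cube a l x ->
  `|b x - cube_average b (cube a l)| <= K * mass w a l `^ g * w x}.
Proof.
have [C C1 wC] := A1_mass_le wA1; have C0 : 0 <= C := le_trans ler01 C1.
have [K K0 bK] := oscillation_cube_ae.
pose D : R := A * C * 2 ^+ n.+1; have D0 : 0 <= D by rewrite !mulr_ge0// exprn_ge0.
pose E : R := C * 2 ^+ n.+1; have E0 : 0 <= E by rewrite mulr_ge0// exprn_ge0.
exists ((K + D) * E `^ g); first by rewrite mulr_ge0 ?addr_ge0 ?powR_ge0.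
(* Rational cubes are enumerated through [unpickle]; codes of no cube impose nothing. *)
pose P k (x : CV) := if (unpickle k : option ('rV[rat]_n.+1 * rat)) is Some (q, r)
  then let a := map_mx ratr q : V in let l := ratr r in 0 < l -> cube a l x ->
    `|b x - cube_average b (cube a l)| <= K * mass w a l `^ g * w x else True.
have bP : {ae lambda, forall x, forall k, P k x}.
  apply: ae_foralln => k; rewrite /P; case: (unpickle k) => [[q r]|]; last exact: nearW.
  have [r0|r0] := ltP 0 (ratr r : R); last by apply: nearW => x /=.
  have := bK (map_mx ratr q) (ratr r) r0.
  by apply: filterS => x H /= _.
have wC0 := wC; move: wC bP; apply: filterS2 => x wC bP a l l0 Qx.
have [q [r [r0 sub rl]]] := rational_cube a l0.
have := bP (pickle (q, r)); rewrite /P pickleK /= => /(_ r0 (sub _ Qx)) {bP}.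
set a' := map_mx _ _; set l' := ratr r => bP.
have Px := sub _ Qx.
have bQP : `|cube_average b (cube a l) - cube_average b (cube a' l')| <=
    D * mass w a' l' `^ g * w x by exact: average_diff_le C0 l0 r0 sub rl (wC _ _ r0 Px).
have bb := ler_distD (cube_average b (cube a' l')) (b x) (cube_average b (cube a l)).
rewrite distrC in bQP; apply: (le_trans (le_trans bb (lerD bP bQP))).
have mPQ : mass w a' l' <= E * mass w a l.
  have v0 := cube_volume_gt0 c_gt0 l0.
  rewrite -(ler_pM2l v0); apply: le_trans (A1_doubling wA1 wC0 C0 l0 r0 sub) _.
  rewrite [leRHS]mulrA; apply: ler_wpM2r; first exact: ltW (mass_gt0 _ l0).
  have -> : cube_volume n l * E = C * (2 ^+ n.+1 * cube_volume n l) by rewrite /E; ring.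
  by apply: ler_wpM2l => //; exact: cube_volume_double.
have mg : mass w a' l' `^ g <= E `^ g * mass w a l `^ g.
  by rewrite -powRM ?mass_ge0// ge0_ler_powR ?nnegrE ?mulr_ge0 ?mass_ge0 ?(ltW g_gt0).
have KD0 : 0 <= K + D by exact: addr_ge0.
have main := ler_wpM2r (w_ge0 x) (ler_wpM2l KD0 mg).
have -> : K * mass w a' l' `^ g * w x + D * mass w a' l' `^ g * w x =
    (K + D) * mass w a' l' `^ g * w x by rewrite !mulrDl.
by rewrite (mulrA (K + D)) in main; exact: main.
Qed.

End pointwise_bound.

(** * The sharp function of b restricted to a cube *)

Section sharp_bounds.
Context {R : realType} {n : nat}.
Local Notation V := 'rV[R]_n.+1.
Local Notation CV := (caratheodory_type (@lebesgue_outer R n)).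
Local Notation lambda := (@lebesgueRn R n).
Implicit Types (a : V) (l : R).

Lemma Rintegral_mul_indic (D E : set CV) (f : CV -> R) :
  \int[lambda]_(x in D) (f x * \1_E x) = \int[lambda]_(x in D `&` E) f x.
Proof.
rewrite Rintegral_mkcondr; apply: eq_Rintegral => x _.
rewrite patchE indicE; case: ifPn => xE; first by rewrite mulr1.
by rewrite mulr0.
Qed.

Lemma integrable_mul_indic (D E : set CV) (f : CV -> R) : measurable D -> measurable E ->
  lambda.-integrable D (EFin \o f) -> lambda.-integrable D (EFin \o (fun x => f x * \1_E x)).
Proof.
move=> mD mE fi; apply: (le_integrable mD _ _ fi).
  apply/measurable_EFinP; apply: measurable_funM; last exact: measurable_indic.
  exact/measurable_EFinP/(measurable_int lambda fi).
move=> x _; rewrite lee_fin normrM indicE.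
by case: (x \in E); rewrite ?normr1 ?mulr1// normr0 mulr0.
Qed.

Hypothesis c_gt0 : 0 < @unit_cube_measure R n.
Variable b : V -> R.
Hypothesis b_loc : Rn_locally_integrable b.

Let mQ a l : measurable (cube a l : set CV). Proof. exact: measurable_cube. Qed.
Let bi a l : lambda.-integrable (cube a l) (EFin \o b).
Proof. exact: cube_integrable. Qed.

Variables (a : V) (l : R).
Hypothesis l_gt0 : 0 < l.
Local Notation Q := (cube a l).
Local Notation f := (b \* \1_Q).

Let fi a' l' : lambda.-integrable (cube a' l') (EFin \o f).
Proof. exact: integrable_mul_indic (mQ _ _) (mQ _ _) (bi _ _). Qed.

Let indic_i a' l' (c : R) : 0 < l' ->
  lambda.-integrable (cube a' l') (EFin \o (fun x => c * \1_Q x)).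
Proof.
by move=> l'0; apply: integrable_mul_indic => //; exact: cst_integrable.
Qed.

Lemma sharp_maximal_term_le a' l' x : 0 < l' -> cube a' l' x ->
  (((cube_volume n l')^-1 * osc f a' l')%:E <= sharp_maximal_fun f x)%E.
Proof.
move=> l'0 Qx; apply: ereal_sup_ubound; exists (cube a' l'); first by split => //; exists a', l'.
rewrite (lebesgueRn_cube _ l'0) (oscillationE fi _ l'0) -/(cube_volume n l').
by rewrite inver gt_eqF ?cube_volume_gt0.
Qed.

(* Test with the cube [Q'] with the same corner and twice the volume of [Q]: there
   [f] has average [b_Q / 2], so [|f - f_Q'|] has integral at least
   [|Q| |b_Q| / 2] over each of [Q] and [Q' \ Q]. *)
Lemma average_le_sharp x : Q x ->
  (`|cube_average b Q|%:E <= 2%:E * sharp_maximal_fun f x)%E.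
Proof.
move=> Qx; pose t : R := 2 `^ n.+1%:R^-1.
have t1 : 1 <= t.
  by rewrite -[leLHS](powRr0 2) ler_powR ?ler1n ?invr_ge0.
have td : t ^+ n.+1 = 2 by rewrite -powR_mulrn ?powR_ge0// -powRrM mulVf ?powRr1 ?pnatr_eq0.
have l'0 : 0 < t * l by rewrite mulr_gt0// (lt_le_trans ltr01).
pose Q' := cube a (t * l).
have sub : Q `<=` Q'.
  by apply: subset_box => i; rewrite ?lexx// !mxE lerD2l ler_peMl ?(ltW l_gt0).
have v0 := cube_volume_gt0 c_gt0 l_gt0.
have v' : cube_volume n (t * l) = 2 * cube_volume n l by rewrite cube_volumeM td.
set bQ := cube_average b Q; pose c : R := bQ / 2.
have QQ : Q' `&` Q = Q by rewrite setIC; exact/setIidPl.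
have bQE : \int[lambda]_(y in Q) b y = bQ * cube_volume n l.
  by rewrite /bQ cube_averageE// mulrC mulVKf// gt_eqF.
have fQ' : cube_average f Q' = c.
  rewrite cube_averageE// Rintegral_mul_indic QQ bQE v' /c.
  by field; rewrite gt_eqF.
(* [k] is f - c on [Q] and c - f off [Q]: |k| still integrates to the oscillation, while the two
   contributions to the integral of [k] add up instead of cancelling. *)
pose k y : R := f y - (2 * c * \1_Q y - c).
have i1 := indic_i a (2 * c) l'0; have i2 := cst_integrable a c l'0.
have i3 : lambda.-integrable Q' (EFin \o (fun y => 2 * c * \1_Q y - c)).
  exact: (integrableB (mQ _ _) i1 i2).
have ki : lambda.-integrable Q' (EFin \o k).
  exact: (integrableB (mQ _ _) (fi _ _) i3).
have Ik : \int[lambda]_(y in Q') k y = bQ * cube_volume n l.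
  rewrite (RintegralB (mQ _ _) (fi _ _) i3) (RintegralB (mQ _ _) i1 i2).
  by rewrite !Rintegral_mul_indic QQ bQE !integral_cst_cube// v' /c; field.
have oscE : osc f a (t * l) = \int[lambda]_(y in Q') `|k y|.
  apply: eq_Rintegral => y _; rewrite -/Q' fQ' /k /= indicE.
  case: (y \in Q) => /=; rewrite ?mulr1 ?mulr0 ?sub0r ?normrN ?opprK ?add0r//.
  by congr `|_|; ring.
have := sharp_maximal_term_le l'0 (sub _ Qx).
have : `|bQ| / 2 <= (cube_volume n (t * l))^-1 * osc f a (t * l).
  rewrite v' ler_pdivlMl; last by rewrite pmulr_rgt0.
  rewrite oscE.
  have := le_normr_Rintegral (mQ _ _) ki; rewrite Ik normrM (gtr0_norm v0).
  by move/(le_trans _); apply; rewrite le_eqVlt; apply/orP; left; apply/eqP; field.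
rewrite -lee_fin => /le_trans h /h; rewrite EFinM => {}h.
have := lee_wpmul2l (_ : 0 <= 2%:E)%E h; rewrite lee_fin => /(_ (ler0n _ 2)).
by rewrite -!EFinM mulrC divfK.
Qed.

(** The supremum in M# includes cubes leaving [Q], where b is cut off. A cube shorter than [Q] is
    slid back into [Q] one coordinate at a time without losing any point of [Q]; otherwise [Q]
    itself is taken. *)
Lemma cube_capture a' l' : 0 < l' -> exists a2 l2, [/\ 0 < l2, l2 <= l',
  cube a2 l2 `<=` Q & Q `&` cube a' l' `<=` cube a2 l2].
Proof.
move=> l'0; have [ll|ll] := leP l l'; first by exists a, l; split => // x [].
pose a2 : V := \row_i Num.min (Num.max (a ord0 i) (a' ord0 i)) (a ord0 i + l - l').
exists a2, l'; split => //.
  apply: subset_box => i; rewrite !mxE.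
    by rewrite le_min le_max lexx/= lerBrDr lerD2l ltW.
  by rewrite -lerBrDr ge_min lexx orbT.
move=> y [/cubeP Qy /cubeP Q'y]; apply/cubeP => i.
have /andP[h1 h2] := Qy i; have /andP[h3 h4] := Q'y i; rewrite mxE.
apply/andP; split; first by rewrite ge_min ge_max h1 h3.
rewrite -lerBlDr le_min le_max; apply/andP; split; last by rewrite lerBlDr subrK.
by apply/orP; right; rewrite lerBlDr.
Qed.

(** Split [f] into c 1_Q and h = (b - c) 1_Q. The first has mean oscillation at most c/2, the second
    at most 2N, since by [cube_capture] the mean of |h| over any cube through [x] is at most N. *)
Lemma sharp_le (c N : R) x : Q x -> 0 <= c -> 0 <= N ->
  (forall a2 l2, 0 < l2 -> cube a2 l2 `<=` Q -> cube a2 l2 x ->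
    \int[lambda]_(y in cube a2 l2) `|b y - c| <= N * cube_volume n l2) ->
  (2%:E * sharp_maximal_fun f x <= (c + 4 * N)%:E)%E.
Proof.
move=> Qx c0 N0 bN.
have -> : ((c + 4 * N)%:E = 2%:E * (c / 2 + 2 * N)%:E)%E.
  by rewrite -EFinM; congr EFin; field.
apply: lee_wpmul2l; first by rewrite lee_fin.
apply: ge_ereal_sup => _ [_ [[a' [l' l'0 ->]] Q'x] <-].
rewrite -/(cube a' l') in Q'x *; set Q' := cube a' l'.
have v0 := cube_volume_gt0 c_gt0 l'0.
rewrite (lebesgueRn_cube _ l'0) (oscillationE fi _ l'0) -/(cube_volume n l').
rewrite inver gt_eqF// -EFinM lee_fin ler_pdivrMl//.
have mQ' : measurable (Q' : set CV) by exact: mQ.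
have ci := cst_integrable a' _ l'0.
pose h (y : CV) : R := (b y - c) * \1_Q y.
have hi : lambda.-integrable Q' (EFin \o h).
  have bci : lambda.-integrable Q' (EFin \o (fun y => b y - c)).
    exact: (integrableB (mQ _ _) (bi _ _) (ci c)).
  exact: integrable_mul_indic (mQ _ _) (mQ _ _) bci.
have nhi : lambda.-integrable Q' (EFin \o (fun y => `|h y|)) by exact: integrable_norm.
have ci1 : lambda.-integrable Q' (EFin \o (fun y : CV => c * (1 * \1_Q y))).
  exact: (integrableZl mQ' c (indic_i a' 1 l'0)).
have fE y : f y = c * \1_Q y + h y by rewrite /h /= -mulrDl addrC subrK.
pose al : R := (cube_volume n l')^-1 * \int[lambda]_(y in Q') (1 * \1_Q y).
have IalE : \int[lambda]_(y in Q') (1 * \1_Q y) = al * cube_volume n l'.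
  by rewrite /al mulrAC mulVf ?mul1r// gt_eqF.
have i1 := indic_i a' 1 l'0.
have ind01 (y : CV) : 0 <= (1 : R) * \1_Q y <= 1.
  by rewrite mul1r indicE; case: (y \in Q); rewrite ?ler01 ?lexx.
have al0 : 0 <= al.
  rewrite /al mulr_ge0 ?invr_ge0 ?(ltW v0)//; apply: Rintegral_ge0 => y _.
  by case/andP : (ind01 y).
have al1 : al <= 1.
  rewrite /al ler_pdivrMl// mulr1 -[leRHS]mul1r -(integral_cst_cube a' 1 l'0).
  by apply: (le_Rintegral mQ' i1 (ci 1)) => y _; case/andP : (ind01 y).
pose hb := cube_average h Q'.
have fQ' : cube_average f Q' = c * al + hb.
  rewrite /hb !cube_averageE//.
  have -> : \int[lambda]_(y in Q') f y =
      \int[lambda]_(y in Q') (c * (1 * \1_Q y) + h y).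
    by apply: eq_Rintegral => y _; rewrite fE mul1r.
  rewrite (RintegralD mQ' ci1 hi) (RintegralZl c mQ' i1) IalE.
  by field; rewrite gt_eqF.
(* As [al] is in [0,1], |1_Q - al| = al + (1 - 2 al) 1_Q, which is affine in the indicator and
   integrates to 2 al (1 - al) times the volume. *)
have bound y : `|f y - cube_average f Q'| <=
    c * (al + (1 - 2 * al) * (1 * \1_Q y)) + (`|h y| + `|hb|).
  have -> : f y - cube_average f Q' = c * (1 * \1_Q y - al) + (h y - hb).
    by rewrite fQ' fE; ring.
  apply: (le_trans (ler_normD _ _)); apply: lerD; last exact: ler_normB.
  rewrite normrM (ger0_norm c0) ler_wpM2l// indicE.
  case: (y \in Q) => /=; rewrite ?mulr1 ?mulr0 ?addr0 ?sub0r ?normrN.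
    by rewrite ger0_norm ?subr_ge0// le_eqVlt; apply/orP; left; apply/eqP; ring.
  by rewrite ger0_norm.
have bi1 : lambda.-integrable Q' (EFin \o (fun y => al + (1 - 2 * al) * (1 * \1_Q y))).
  exact: (integrableD mQ' (ci al) (integrableZl mQ' (1 - 2 * al) i1)).
have bi2 : lambda.-integrable Q' (EFin \o (fun y => `|h y| + `|hb|)).
  exact: (integrableD mQ' nhi (ci _)).
have bi1c : lambda.-integrable Q'
    (EFin \o (fun y => c * (al + (1 - 2 * al) * (1 * \1_Q y)))).
  exact: (integrableZl mQ' c bi1).
have bi12 : lambda.-integrable Q' (EFin \o (fun y =>
    c * (al + (1 - 2 * al) * (1 * \1_Q y)) + (`|h y| + `|hb|))).
  exact: (integrableD mQ' bi1c bi2).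
have E1 : \int[lambda]_(y in Q') (al + (1 - 2 * al) * (1 * \1_Q y)) =
    al * cube_volume n l' + (1 - 2 * al) * (al * cube_volume n l').
  rewrite (RintegralD mQ' (ci al) (integrableZl mQ' (1 - 2 * al) i1)).
  by rewrite (integral_cst_cube a' al l'0) (RintegralZl _ mQ' i1) IalE.
have E2 : \int[lambda]_(y in Q') (`|h y| + `|hb|) =
    \int[lambda]_(y in Q') `|h y| + `|hb| * cube_volume n l'.
  by rewrite (RintegralD mQ' nhi (ci _)) (integral_cst_cube a' _ l'0).
have oscle : osc f a' l' <=
    c * (al * cube_volume n l' + (1 - 2 * al) * (al * cube_volume n l')) +
    (\int[lambda]_(y in Q') `|h y| + `|hb| * cube_volume n l').
  rewrite -E1 -E2 -(RintegralZl c mQ' bi1) -(RintegralD mQ' bi1c bi2).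
  apply: (le_Rintegral mQ' (subc_norm_integrable fi _ _ l'0) bi12) => y _.
  exact: bound.
have hb_le : `|hb| * cube_volume n l' <= \int[lambda]_(y in Q') `|h y|.
  have := le_normr_Rintegral mQ' hi.
  have -> : \int[lambda]_(y in Q') h y = hb * cube_volume n l'.
    by rewrite /hb cube_averageE// mulrC mulVKf// gt_eqF.
  by rewrite normrM (gtr0_norm v0).
have h_le : \int[lambda]_(y in Q') `|h y| <= N * cube_volume n l'.
  have [a2 [l2 [l20 l2l sub cap]]] := cube_capture a' l'0.
  have b2i a3 l3 : 0 < l3 -> lambda.-integrable (cube a3 l3) (EFin \o (fun y => `|b y - c|)).
    exact: subc_norm_integrable.
  have bQi : lambda.-integrable (Q' `&` Q) (EFin \o (fun y => `|b y - c|)).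
    by apply: integrableS (b2i a' l' l'0) => //; exact: measurableI.
  have -> : \int[lambda]_(y in Q') `|h y| = \int[lambda]_(y in Q' `&` Q) `|b y - c|.
    rewrite -Rintegral_mul_indic; apply: eq_Rintegral => y _; rewrite /h normrM indicE.
    by case: (y \in Q); rewrite ?normr1// normr0.
  apply: (@le_trans _ _ (\int[lambda]_(y in cube a2 l2) `|b y - c|)).
    rewrite /Rintegral; apply: fine_le.
    - exact: (integrable_fin_num (measurableI _ _ mQ' (mQ a l)) bQi).
    - exact: (integrable_fin_num (mQ _ _) (b2i a2 l2 l20)).
    apply: ge0_subset_integral; [exact: measurableI|exact: mQ| | |].
    - exact: (measurable_int lambda (b2i a2 l2 l20)).
    - by move=> y _; rewrite lee_fin.
    - by rewrite setIC.
  apply: le_trans (bN a2 l2 l20 sub _) _; first exact: cap.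
  rewrite ler_wpM2l// /cube_volume ler_pM2l// lerXn2r ?nnegrE ?(ltW l20)//.
  exact: ltW.
apply: (le_trans oscle).
have quad : al + (1 - 2 * al) * al <= 2^-1.
  rewrite -subr_ge0 (_ : _ - _ = 2 * (al - 2^-1) ^+ 2); last by field.
  by rewrite mulr_ge0// sqr_ge0.
have ineq1 : c * (al * cube_volume n l' + (1 - 2 * al) * (al * cube_volume n l')) <=
    c / 2 * cube_volume n l'.
  rewrite [leLHS](_ : _ = c * (al + (1 - 2 * al) * al) * cube_volume n l'); last by ring.
  by rewrite ler_wpM2r ?(ltW v0)// ler_wpM2l.
apply: le_trans (lerD ineq1 (lerD h_le (le_trans hb_le h_le))) _.
by rewrite le_eqVlt; apply/orP; left; apply/eqP; ring.
Qed.

End sharp_bounds.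

(** * The sharp condition *)

(** Clears the normalizations and the root in a term of [sharp_condition], with [m] the mass of the
    cube and [k] its power m^g. *)
Lemma power_mean_le (R : realType) (m k C s : R) (I : \bar R) :
  0 < m -> 0 < k -> 0 <= C -> 0 < s -> (0 <= I)%E ->
  ((k%:E)^-1 * ((m%:E)^-1 * I) `^ s^-1 <= C%:E)%E <->
  (I <= (m * (k * C) `^ s)%:E)%E.
Proof.
move=> m0 k0 C0 s0 I0; rewrite !inver !gt_eqF// lee_pdivrMl// -EFinM.
have kC0 : 0 <= k * C by rewrite mulr_ge0 ?(ltW k0).
have mI0 : (0 <= m^-1%:E * I)%E by rewrite mule_ge0// lee_fin invr_ge0 ltW.
have nng (x : \bar R) : (0 <= x)%E -> x \in `[0%E, +oo%E].
  by move=> x0; rewrite in_itv/= x0 leey.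
have -> : ((m * (k * C) `^ s)%:E = m%:E * (k * C)%:E `^ s)%E.
  by rewrite poweR_EFin EFinM.
rewrite -lee_pdivrMl//; split=> [h|h].
  have := gt0_ler_poweR (ltW s0) (nng _ (poweR_ge0 _ _)) (nng _ _) h.
  by rewrite -poweRrM mulVf ?gt_eqF// poweRe1//; apply; rewrite lee_fin.
have sV0 : 0 <= s^-1 by rewrite invr_ge0 ltW.
have := gt0_ler_poweR sV0 (nng _ mI0) (nng _ (poweR_ge0 _ _)) h.
by rewrite -poweRrM mulfV ?gt_eqF// poweRe1// lee_fin.
Qed.

Section ge0_integral_monotone.
Local Open Scope ereal_scope.
Context d (T : measurableType d) (R : realType) (mu : {measure set T -> \bar R}).
Import HBNNSimple.

(* The sharp function enters without a proof of its measurability; the integral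
   of a nonmeasurable nonnegative function is here its lower integral. *)
Lemma ge0_le_lower_integral (D : set T) (f1 f2 : T -> \bar R) :
  (forall x, D x -> 0 <= f1 x) -> (forall x, D x -> f1 x <= f2 x) ->
  \int[mu]_(x in D) f1 x <= \int[mu]_(x in D) f2 x.
Proof.
move=> f10 f12; have f20 x : D x -> 0 <= f2 x by move=> Dx; rewrite (le_trans (f10 _ Dx))// f12.
rewrite !ge0_integralE//; apply: le_ereal_sup => _ [h hf <-]; exists h => // x.
apply: le_trans (hf x) _; rewrite !patchE; case: ifPn => // /set_mem; exact: f12.
Qed.

(** [f1] may be nonmeasurable: its integral is a supremum over simple functions below it, and each
    of these is measurable and almost everywhere below [f2]. *)
Lemma ae_ge0_le_lower_integral (D : set T) (f1 f2 : T -> \bar R) : measurable D ->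
  (forall x, D x -> 0 <= f1 x) -> (forall x, D x -> 0 <= f2 x) ->
  measurable_fun D f2 -> {ae mu, forall x, D x -> f1 x <= f2 x} ->
  \int[mu]_(x in D) f1 x <= \int[mu]_(x in D) f2 x.
Proof.
move=> mD f10 f20 mf2 f12; rewrite [leLHS]ge0_integralE//.
apply: ge_ereal_sup => _ [h hf <-]; rewrite -integralT_nnsfun integral_mkcond.
rewrite [leRHS]integral_mkcond; apply: ae_ge0_le_integral => //.
- by move=> x _; rewrite patchE; case: ifPn => // _; rewrite lee_fin.
- apply/(measurable_restrictT _ _).1 => //; exact/measurable_EFinP.
- by move=> x _; rewrite patchE; case: ifPn => // /set_mem/f20.
- exact/(measurable_restrictT _ _).1.
apply: filterS f12 => x f12 _; rewrite patchT ?in_setT//.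
apply: le_trans (hf x) _; rewrite !patchE; case: ifPn => // /set_mem; exact: f12.
Qed.

End ge0_integral_monotone.

(** If x > t y, then x = x^s x^(1-s) <= x^s (t y)^(1-s) because 1 - s <= 0; otherwise the first term
    is already enough. *)
Lemma powR_young (R : realType) (s t x y : R) : 1 <= s -> 0 < t -> 0 < y -> 0 <= x ->
  x <= t * y + t `^ (1 - s) * (x `^ s * y `^ (1 - s)).
Proof.
move=> s1 t0 y0 x0; have ty0 : 0 < t * y by rewrite mulr_gt0.
have [xty|tyx] := leP x (t * y).
  by rewrite (le_trans xty)// lerDl !mulr_ge0 ?powR_ge0.
have xp : 0 < x by exact: lt_trans tyx.
rewrite mulrCA -powRM ?(ltW t0) ?(ltW y0)//.
apply: (@le_trans _ _ (x `^ s * (t * y) `^ (1 - s))); last by rewrite lerDr ltW.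
have -> : 1 - s = - (s - 1) by rewrite opprB.
rewrite powRN ler_pdivlMr ?powR_gt0//.
rewrite -[leRHS](@mulr_powRB1 _ x s) ?(ltW xp) ?(lt_le_trans ltr01)//.
rewrite ler_wpM2l// ge0_ler_powR ?nnegrE ?subr_ge0 ?(ltW ty0) ?(ltW xp)//.
exact: ltW.
Qed.

Lemma pos_part_le_abse_sub (R : realType) (r q : R) (y : \bar R) :
  (q%:E <= y)%E -> ((Num.max 0 (q - r))%:E <= `|r%:E - y|)%E.
Proof.
case: y => [y|_|]; [|by rewrite leey|by rewrite leeNy_eq].
rewrite /= !lee_fin => qy; rewrite ge_max normr_ge0/= distrC.
by rewrite (le_trans _ (ler_norm _))// lerD2r.
Qed.

Lemma abse_sub_le (R : realType) (x N : R) (y : \bar R) : 0 <= N ->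
  ((x - N)%:E <= y)%E -> (y <= (x + 4 * N)%:E)%E -> (`|x%:E - y| <= (4 * N)%:E)%E.
Proof.
move=> N0; case: y => [y| |]; [|by rewrite leye_eq|by rewrite leeNy_eq].
by rewrite /= !lee_fin => lo up; rewrite ler_norml; apply/andP; split; lra.
Qed.

Section characterization.
Context {R : realType} {n : nat}.
Local Notation V := 'rV[R]_n.+1.
Local Notation CV := (caratheodory_type (@lebesgue_outer R n)).
Local Notation lambda := (@lebesgueRn R n).
Implicit Types (a : V) (l : R).

Variables (beta : R) (b w : V -> R).
Hypothesis beta_gt0 : 0 < beta.
Hypothesis b_loc : Rn_locally_integrable b.
Hypothesis wA1 : A1 w.
Local Notation g := (beta / n.+1%:R).

Let c_gt0 := A1_unit_cube_measure wA1.
Let g_gt0 : 0 < g. Proof. by rewrite divr_gt0. Qed.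
Let w_ge0 (x : CV) : 0 <= w x. Proof. by case: wA1 => -[]. Qed.
Let w_loc : Rn_locally_integrable w. Proof. by case: wA1 => -[]. Qed.
Let mQ a l : measurable (cube a l : set CV). Proof. exact: measurable_cube. Qed.
Let bi a l : lambda.-integrable (cube a l) (EFin \o b).
Proof. exact: cube_integrable. Qed.
Let wi a l : lambda.-integrable (cube a l) (EFin \o w).
Proof. exact: cube_integrable. Qed.
Let mass_gt0 a l : 0 < l -> 0 < mass w a l.
Proof. exact: (A1_ae_gt0_mass_gt0 wA1).2. Qed.

Lemma Lip_oscP : Lip beta w b <-> exists2 A, 0 <= A &
  forall a l, 0 < l -> osc b a l <= A * mass w a l `^ (1 + g).
Proof.
have termE a l : 0 < l ->
    ((weight_measure w (cube a l) `^ (1 + g))^-1 * oscillation b (cube a l) =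
    ((mass w a l `^ (1 + g))^-1 * osc b a l)%:E)%E.
  move=> l0; rewrite (weight_measureE wA1) (oscillationE bi _ l0) poweR_EFin.
  by rewrite inver gt_eqF ?powR_gt0 ?mass_gt0.
split=> [[_ Ly]|[A A0 oscA]]; last first.
  split => //; rewrite (@le_lt_trans _ _ A%:E) ?ltry//.
  apply: ge_ereal_sup => _ [_ [a [l l0 ->]] <-].
  by rewrite [leLHS](termE _ _ l0) lee_fin ler_pdivrMl ?powR_gt0 ?mass_gt0// mulrC oscA.
have term_le a l : 0 < l ->
    (((mass w a l `^ (1 + g))^-1 * osc b a l)%:E <= Lip_norm beta w b)%E.
  by move=> l0; rewrite -termE//; apply: ereal_sup_ubound; exists (cube a l) => //; exists a, l.
have osc0 a l : 0 <= osc b a l by exact: Rintegral_ge0.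
have L0 : (0 <= Lip_norm beta w b)%E.
  by apply: le_trans (term_le 0 1 ltr01); rewrite lee_fin mulr_ge0 ?invr_ge0 ?powR_ge0.
have Lfin : Lip_norm beta w b \is a fin_num by rewrite ge0_fin_numE.
exists (fine (Lip_norm beta w b)); first exact: fine_ge0.
move=> a l l0; rewrite mulrC -ler_pdivrMl ?powR_gt0 ?mass_gt0//.
by rewrite -lee_fin fineK// term_le.
Qed.

Definition sharp_integrand s a l (x : V) : \bar R :=
  (`|(b x)%:E - 2%:E * sharp_maximal_fun (b \* \1_(cube a l))%R x| `^ s
   * (w x `^ (1 - s))%:E)%E.

Lemma sharp_integrand_ge0 s a l x : (0 <= sharp_integrand s a l x)%E.
Proof. by rewrite mule_ge0 ?poweR_ge0// lee_fin powR_ge0. Qed.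

Lemma sharp_conditionP s : 1 <= s -> sharp_condition beta w b s <->
  exists2 C, 0 < C & forall a l, 0 < l ->
  (\int[lambda]_(x in cube a l) sharp_integrand s a l x <=
   (mass w a l * (mass w a l `^ g * C) `^ s)%:E)%E.
Proof.
move=> s1; have s0 : 0 < s := lt_le_trans ltr01 s1.
have I0 a l : (0 <= \int[lambda]_(x in cube a l) sharp_integrand s a l x)%E.
  by apply: integral_ge0 => x _; exact: sharp_integrand_ge0.
split=> [[C supC]|[C C0 HC]].
  (* A positive constant is wanted because it enters the parameter [t] of [powR_young]. *)
  exists (Num.max C 1); first by rewrite lt_max ltr01 orbT.
  move=> a l l0; have C0 : 0 <= Num.max C 1 by rewrite le_max ler01 orbT.
  have kg : 0 < mass w a l `^ g by exact: powR_gt0 (mass_gt0 _ l0).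
  apply/(power_mean_le (mass_gt0 a l0) kg C0 s0 (I0 a l)).
  apply: le_trans (_ : C%:E <= _)%E; last by rewrite lee_fin le_max lexx.
  apply: le_trans supC; apply: ereal_sup_ubound.
  exists (cube a l); first by exists a, l.
  by rewrite (weight_measureE wA1) poweR_EFin.
exists C; apply: ge_ereal_sup => _ [_ [a [l l0 ->]] <-].
have kg : 0 < mass w a l `^ g by exact: powR_gt0 (mass_gt0 _ l0).
rewrite -/(cube a l) (weight_measureE wA1) poweR_EFin.
by apply/(power_mean_le (mass_gt0 a l0) kg (ltW C0) s0 (I0 a l)); exact: HC.
Qed.

Lemma Lip_sharp_condition s : 1 <= s -> Lip beta w b ->
  {ae lambda, forall x, 0 <= b x} -> sharp_condition beta w b s.
Proof.
move=> s1 /Lip_oscP[A A0 oscA] b_ge0; apply/(sharp_conditionP s1).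
have s0 : 0 < s := lt_le_trans ltr01 s1.
have [C C1 wC] := A1_mass_le wA1; have C0 : 0 <= C := le_trans ler01 C1.
have [K K0 bK] := oscillation_ae wA1 b_loc g_gt0 A0 oscA.
(* On a cube through [x], the mean of |b - b(x)| is at most the mean oscillation, which yields A C
   after the A1 bound, plus |b_Q - b(x)|, which yields K. *)
pose M : R := A * C + K; have M0 : 0 <= M by rewrite addr_ge0// mulr_ge0.
have KM : K <= M by rewrite lerDr mulr_ge0.
have MC : A * C + K <= M by [].
(* The factor 4 is that of [sharp_le]; adding 1 keeps [B] positive when [M] is 0. *)
clearbody M; pose B : R := 4 * M + 1.
have B0 : 0 < B by rewrite ltr_wpDl// mulr_ge0.
have MB : 4 * M <= B by rewrite lerDl.
exists B => //.
have key : {ae lambda, forall x, forall a l, 0 < l -> cube a l x ->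
    (`|(b x)%:E - 2%:E * sharp_maximal_fun (b \* \1_(cube a l))%R x|
      <= (mass w a l `^ g * B * w x)%:E)%E}.
  apply: filterS3 b_ge0 wC bK => x bx wx bKx a l l0 Qx.
  set m := mass w a l `^ g; pose N : R := M * m * w x.
  have m0 : 0 <= m by exact: powR_ge0.
  have N0 : 0 <= N by apply: mulr_ge0; [exact: mulr_ge0|exact: w_ge0].
  have bN a2 l2 : 0 < l2 -> cube a2 l2 `<=` cube a l -> cube a2 l2 x ->
      \int[lambda]_(y in cube a2 l2) `|b y - b x| <= N * cube_volume n l2.
    move=> l20 sub Q2x; apply: le_trans (integral_dist_le bi a2 (b x) l20) _.
    have v2 := ltW (cube_volume_gt0 c_gt0 l20).
    have m2 : mass w a2 l2 `^ g <= m.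
      apply: (ge0_ler_powR (ltW g_gt0)); rewrite ?nnegrE; try exact: mass_ge0.
      exact: mass_subset sub.
    have t1 : osc b a2 l2 <= A * C * m * w x * cube_volume n l2.
      apply: le_trans (oscA _ _ l20) _; rewrite powR_1D ?(ltW (mass_gt0 _ l20))//.
      have mm := ler_pM (ltW (mass_gt0 a2 l20)) (powR_ge0 _ _) (wx _ _ l20 Q2x) m2.
      apply: le_trans (ler_wpM2l A0 mm) _.
      by rewrite le_eqVlt; apply/orP; left; apply/eqP; ring.
    have t2 : `|cube_average b (cube a2 l2) - b x| * cube_volume n l2 <=
        K * m * w x * cube_volume n l2.
      rewrite distrC ler_wpM2r//; apply: le_trans (bKx _ _ l20 Q2x) _.
      apply: ler_wpM2r; first exact: w_ge0.
      exact: ler_wpM2l.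
    apply: (le_trans (lerD t1 t2)).
    have mwv : 0 <= m * w x * cube_volume n l2.
      by apply: mulr_ge0 => //; apply: mulr_ge0 => //; exact: w_ge0.
    have -> : N * cube_volume n l2 = M * (m * w x * cube_volume n l2).
      by rewrite /N; ring.
    apply: le_trans (ler_wpM2r mwv MC).
    by rewrite le_eqVlt; apply/orP; left; apply/eqP; ring.
  have lo := average_le_sharp c_gt0 b_loc l0 Qx.
  have up := sharp_le c_gt0 b_loc l0 Qx bx N0 bN.
  have mid : `|b x - cube_average b (cube a l)| <= N.
    apply: le_trans (bKx _ _ l0 Qx) _; apply: ler_wpM2r; first exact: w_ge0.
    exact: ler_wpM2r.
  have NB : 4 * N <= m * B * w x.
    rewrite /N mulrA mulrA (mulrC m); apply: ler_wpM2r; first exact: w_ge0.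
    exact: ler_wpM2r.
  have lo' : b x - N <= `|cube_average b (cube a l)|.
    rewrite lerBlDr -lerBlDl.
    by apply: le_trans (le_trans (ler_norm _) mid); rewrite lerB// ler_norm.
  apply: le_trans (_ : (4 * N)%:E <= _)%E; last by rewrite lee_fin.
  by apply: abse_sub_le => //; apply: le_trans lo; rewrite lee_fin.
move=> a l l0.
have mwC : measurable_fun (cube a l)
    (fun x : CV => (((mass w a l `^ g * B) `^ s)%:E * (w x)%:E)%E).
  by apply: measurable_funeM; exact: (measurable_int lambda (wi a l)).
have mB0 : 0 <= (mass w a l `^ g * B) by rewrite mulr_ge0 ?powR_ge0 ?(ltW B0).
apply: (@le_trans _ _ (\int[lambda]_(x in cube a l)
    (((mass w a l `^ g * B) `^ s)%:E * (w x)%:E))%E); last first.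
  rewrite ge0_integralZl//.
  - by rewrite -/(weight_measure w _) (weight_measureE wA1) -EFinM lee_fin mulrC.
  - exact: (measurable_int lambda (wi a l)).
  - by move=> x _; rewrite lee_fin.
  - by rewrite lee_fin powR_ge0.
apply: ae_ge0_le_lower_integral => //.
- by move=> x _; exact: sharp_integrand_ge0.
- by move=> x _; rewrite -EFinM lee_fin mulr_ge0 ?powR_ge0.
have [w_gt0 _] := A1_ae_gt0_mass_gt0 wA1.
move: w_gt0 key; apply: filterS2 => x wx0 key Qx; have {key} := key a l l0 Qx.
rewrite /sharp_integrand.
have nng (y : \bar R) : (0 <= y)%E -> y \in `[0%E, +oo%E].
  by move=> y0; rewrite in_itv/= y0 leey.
move=> /(gt0_ler_poweR (ltW s0) (nng _ (abse_ge0 _)) (nng _ _)) h.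
have {h} := h _; rewrite lee_fin mulr_ge0// => /(_ isT).
rewrite poweR_EFin => h; apply: (le_trans (lee_wpmul2r _ h)).
  by rewrite lee_fin powR_ge0.
rewrite -!EFinM lee_fin powRM// -mulrA ler_wpM2l ?powR_ge0//.
by rewrite -powRD ?(gt_eqF wx0) ?implybT// addrC subrK powRr1.
Qed.

Let pos_part_i (c : R) a l : 0 < l ->
  lambda.-integrable (cube a l) (EFin \o (fun x => Num.max 0 (c - b x))).
Proof.
move=> l0; apply: (le_integrable (mQ a l) _ _ (subc_norm_integrable bi a c l0)).
  apply/measurable_EFinP; apply: measurable_maxr; first exact: measurable_cst.
  apply: measurable_funB; first exact: measurable_cst.
  by apply/measurable_EFinP; exact: (measurable_int lambda (bi a l)).
move=> x _; rewrite /= lee_fin normr_id distrC.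
by case: (leP 0 (c - b x)) => _; rewrite ?normr0.
Qed.

(* Integrating [powR_young] with [t = C * w(Q) `^ g] replaces Hoelder's inequality. *)
Lemma sharp_condition_pos_part s : 1 <= s -> sharp_condition beta w b s ->
  exists2 A, 0 <= A & forall a l, 0 < l ->
  \int[lambda]_(x in cube a l) Num.max 0 (`|cube_average b (cube a l)| - b x) <=
  A * mass w a l `^ (1 + g).
Proof.
move=> s1 /(sharp_conditionP s1)[C C0 HC]; have s0 : 0 < s := lt_le_trans ltr01 s1.
(* Each of the two terms of [powR_young] contributes at most C mu(Q)^(1+g). *)
exists (2 * C); first by rewrite mulr_ge0 ?(ltW C0).
move=> a l l0; set h := fun x => Num.max 0 _; have m0 := mass_gt0 a l0.
set m := mass w a l in m0 *; pose t : R := m `^ g * C.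
have t0 : 0 < t by rewrite mulr_gt0// powR_gt0.
have h0 (x : CV) : 0 <= h x by rewrite le_max lexx.
have hi : lambda.-integrable (cube a l) (EFin \o (h : CV -> R)) by exact: pos_part_i.
pose F (x : CV) : R := h x `^ s * w x `^ (1 - s).
have F0 x : 0 <= F x by rewrite mulr_ge0 ?powR_ge0.
have mF : measurable_fun (cube a l) F.
  apply: measurable_funM.
    apply: (measurableT_comp (measurable_powR s)).
    by apply/measurable_EFinP; exact: (measurable_int lambda hi).
  apply: (measurableT_comp (measurable_powR (1 - s))).
  by apply/measurable_EFinP; exact: (measurable_int lambda (wi a l)).
have IF : (\int[lambda]_(x in cube a l) (F x)%:E <= (m * t `^ s)%:E)%E.
  apply: le_trans (HC a l l0); apply: ge0_le_lower_integral => x Qx.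
    by rewrite lee_fin.
  rewrite /sharp_integrand EFinM; apply: lee_wpmul2r.
    by rewrite lee_fin powR_ge0.
  rewrite -poweR_EFin; apply: (gt0_ler_poweR (ltW s0)).
  - by rewrite in_itv/= leey lee_fin h0.
  - by rewrite in_itv/= leey abse_ge0.
  by apply: pos_part_le_abse_sub; exact: average_le_sharp.
rewrite -lee_fin /Rintegral (fineK (integrable_fin_num (mQ a l) hi)).
have mw := measurable_int lambda (wi a l).
have mF' : measurable_fun (cube a l) (fun x => (F x)%:E) by exact/measurable_EFinP.
have mtw : measurable_fun (cube a l) (fun x => t%:E * (w x)%:E)%E by exact: measurable_funeM.
have mtF : measurable_fun (cube a l) (fun x => (t `^ (1 - s))%:E * (F x)%:E)%E.
  exact: measurable_funeM.
have tw0 x : (0 <= t%:E * (w x)%:E)%E.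
  by rewrite -EFinM lee_fin; apply: mulr_ge0; [exact: ltW|exact: w_ge0].
have tF0 x : (0 <= (t `^ (1 - s))%:E * (F x)%:E)%E.
  by rewrite -EFinM lee_fin; apply: mulr_ge0; [exact: powR_ge0|exact: F0].
apply: (@le_trans _ _ (\int[lambda]_(x in cube a l)
    (t%:E * (w x)%:E + (t `^ (1 - s))%:E * (F x)%:E))%E).
  apply: ae_ge0_le_lower_integral; first exact: mQ.
  - by move=> x _; rewrite lee_fin.
  - by move=> x _; rewrite adde_ge0.
  - exact: emeasurable_funD.
  have [w_gt0 _] := A1_ae_gt0_mass_gt0 wA1.
  apply: filterS w_gt0 => x wx _; rewrite -!EFinM -EFinD lee_fin.
  exact: powR_young.
rewrite ge0_integralD//.
have wE : (\int[lambda]_(x in cube a l) (t%:E * (w x)%:E) = (t * m)%:E)%E.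
  rewrite ge0_integralZl; [|exact: mQ|exact: mw| |].
  - by rewrite -/(weight_measure w _) (weight_measureE wA1).
  - by move=> x _; rewrite lee_fin w_ge0.
  - by rewrite lee_fin ltW.
have FE : (\int[lambda]_(x in cube a l) ((t `^ (1 - s))%:E * (F x)%:E) <=
    (t `^ (1 - s) * (m * t `^ s))%:E)%E.
  rewrite ge0_integralZl; [|exact: mQ|exact: mF'| |].
  - by rewrite EFinM; apply: lee_wpmul2l => //; rewrite lee_fin powR_ge0.
  - by move=> x _; rewrite lee_fin F0.
  - by rewrite lee_fin powR_ge0.
rewrite wE; apply: le_trans (leeD2l _ FE) _; rewrite -EFinD lee_fin.
have tE : t `^ (1 - s) * t `^ s = t.
  by rewrite -powRD ?(gt_eqF t0) ?implybT// subrK powRr1// ltW.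
rewrite mulrCA tE powR_1D ?(ltW m0)// /t.
by rewrite le_eqVlt; apply/orP; left; apply/eqP; ring.
Qed.

(** The function (|b_Q| - b)^+ dominates both b_Q - b, which [osc_le] turns into an oscillation
    bound, and the negative part of b. The latter does not depend on the cube, so its integral is
    additive over children and [self_improvement] applies. *)
Lemma sharp_condition_Lip s : 1 <= s -> sharp_condition beta w b s ->
  Lip beta w b /\ {ae lambda, forall x, 0 <= b x}.
Proof.
move=> s1 /(sharp_condition_pos_part s1)[A A0 HA].
pose h a l (x : CV) := Num.max 0 (`|cube_average b (cube a l)| - b x).
split.
  apply/Lip_oscP; exists (2 * A); first exact: mulr_ge0.
  move=> a l l0; rewrite -mulrA.
  apply: (@le_trans _ _ (2 * \int[lambda]_(x in cube a l) h a l x)).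
    apply: osc_le => //.
    - exact: pos_part_i.
    - by move=> x; rewrite le_max lexx.
    - by move=> x _; rewrite le_max lerD2r ler_norm orbT.
  by rewrite ler_wpM2l// HA.
pose e a l := \int[lambda]_(x in cube a l) Num.max 0 (0 - b x).
have e_le0 a l : 0 < l -> e a l <= 0.
  apply: (@self_improvement _ _ _ wA1 g A e) => // {a l} a l l0.
    have mb : measurable_fun [set: CV] (fun x => Num.max 0 (0 - b x)).
      apply: measurable_maxr; first exact: measurable_cst.
      by apply: measurable_funB; [exact: measurable_cst|exact: b_loc.1].
    have b0 (x : CV) : 0 <= Num.max 0 (0 - b x) by rewrite le_max lexx.
    have bE := Rintegral_children a l0 mb (fun a l => @pos_part_i 0 a l) b0.
    by rewrite le_eqVlt; apply/orP; left; apply/eqP; exact: esym bE.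
  apply: le_trans (HA a l l0); apply: (le_Rintegral (mQ a l)).
  - exact: pos_part_i.
  - exact: pos_part_i.
  by move=> x _; rewrite ge_max le_max lexx/= le_max lerD2r normr_ge0 orbT.
(* Countably many centered cubes exhaust the space; the index starts at 1 to keep the side
   positive. *)
have : {ae lambda, forall x, forall k, centered_cube k.+1 x -> Num.max 0 (0 - b x) = 0}.
  apply: ae_foralln => k; have k0 : 0 < k.+1%:R *+ 2 :> R by rewrite pmulrn_lgt0.
  apply: Rintegral_le0_ae; [exact: mQ|exact: pos_part_i| |exact: e_le0].
  by move=> x; rewrite le_max lexx.
apply: filterS => x Hx; have [[//|m] _ mx] := centered_cube_cover x 0.
by have /eqP := Hx m mx; rewrite eq_maxl sub0r oppr_le0.
Qed.

End characterization.

Unset Implicit Arguments.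

Theorem corollary1p2 (R : realType) (n : nat) (beta : R)
    (b mu : 'rV[R]_n.+1 -> R) :
  0 < beta < 1 -> Rn_locally_integrable b -> A1 mu ->
  [<-> Lip beta mu b /\ {ae @lebesgueRn R n, forall x, 0 <= b x};
       exists2 s : R, 1 <= s & sharp_condition beta mu b s;
       forall s : R, 1 <= s -> sharp_condition beta mu b s].
Proof.
move=> /andP[beta0 _] b_loc muA1.
have pos_Lip s := @sharp_condition_Lip _ _ _ _ _ beta0 b_loc muA1 s.
have Lip_sharp s := @Lip_sharp_condition _ _ _ _ _ beta0 b_loc muA1 s.
tfae.
- by move=> [bLip b0]; exists 1 => //; exact: Lip_sharp.
- by move=> [s s1 /(pos_Lip _ s1)[bLip b0]] t t1; exact: Lip_sharp.
- by move=> /(_ 1 (lexx 1))/(pos_Lip _ (lexx 1)).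
Qed.
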